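(* Let $p$ be an odd prime, let $\ell\ge1$ be a fixed integer and let $N$ be an integer with $1\le N<p/\ell$. For $a\in\mathbb{F}_p^*$ let $G_\ell(a,N)$ be the number of $\ell$-tuples of positive integers $(n_1,\dots,n_\ell)$ with $n_1+\dots+n_\ell=N$ and $$\prod_{i=1}^{\ell}n_i!\equiv a\pmod p.$$ Then $$\max_{a\in\mathbb{F}_p^*}\left|G_\ell(a,N)-\frac{1}{p-1}\binom{N-1}{\ell-1}\right|\ll N^{3\ell/4}p^{(\ell+6)/8}(\log p)^{(\ell-2)/4}.$$
   Context: The implied constant may depend on $\ell$ but not on $p,N,a$. *)

(* Defs.v *)
From HB Require Import structures.
From mathcomp Require Import all_boot all_order all_algebra.
From mathcomp Require Import all_classical all_reals all_analysis.

Set Implicit Arguments.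
Unset Strict Implicit.
Unset Printing Implicit Defensive.

Local Open Scope ring_scope.

(* Entries are drawn from 'I_N.+1 only to have a finite type: positive integers
   (indeed natural numbers) with sum N are all at most N, so no tuple is lost. *)
Definition G (p l : nat) (a : 'F_p) (N : nat) : nat :=
  #|[set n : {ffun 'I_l -> 'I_N.+1} |
      [&& [forall i, (0 < n i)%N],
          (\sum_(i < l) n i)%N == N &
          (\prod_(i < l) (n i)`!)%:R == a]]|.

(* Main.v *)
(** Expanding the congruence in multiplicative characters [chi] modulo [p] and the
    condition on the sum in additive ones reduces the theorem to
    [|sum_(n <= N) chi(n!) psi(b n)| << N^(3/4) p^(1/8)] for [chi] nontrivial.  Since
    [(n + k)! = n! (n + 1) ... (n + k)], shifting [n] by [k < M] and Cauchy-Schwarz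
    reduce that sum to incomplete sums of [chi((n + k + 1) ... (n + m))].  These are
    completed with the majorant [#{(u, v) : u - v = x, u, v < 2 N}], whose Fourier
    coefficients are nonnegative with bounded sum, so no logarithm is lost.

    What remains is Weil's bound [|sum_x chi(f(x)) psi(c x)| <= deg f sqrt p] for [f]
    a product of distinct linear factors.  The L-function attached to [(chi, psi)] is a
    polynomial of degree at most [deg f], so the sums [S_n(c)] over [F_(p^n)] are minus
    the power sums of its reciprocal roots.  Summing [S_n(c)] over all [c] gives the pure
    character sum of [chi(f(z^p - z))] over [F_(p^n)], which Stepanov's method bounds by
    a constant times [p^(n/2)]; hence all these roots have modulus at most [sqrt p]. *)

Require Import Defs.
From HB Require Import structures.
From mathcomp Require Import all_boot all_order all_fingroup all_algebra.
From mathcomp Require Import all_solvable all_field.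
From mathcomp Require Import zify ring lra.
Import Order.TTheory GRing.Theory Num.Theory.

Set Implicit Arguments.
Unset Strict Implicit.
Unset Printing Implicit Defensive.

Local Open Scope ring_scope.

(** * Stepanov's method *)

(** Stepanov's construction bounds each fibre of the norm only from above, and with a constant that
    grows with [p]. Neither defect matters: the fibres add up to [p ^ n], so upper bounds for all of
    them give a two-sided estimate, and the modulus of the reciprocal roots is decided by the growth
    rate of their power sums, whatever the constant. Summing over all [c] removes the additive
    character; since the roots for all [c] are pooled, a bound for the pool bounds the roots for
    each single [c]. In the Fourier expansion of the condition on the sum, two of the [l] factors
    are spent on Parseval and the other [l - 2] are bounded uniformly. Characters take values in
    [algC], whereas the theorem speaks of an arbitrary [realType]. The estimate crosses over as an
    inequality between natural numbers, with eighth powers clearing the roots. *)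

Lemma homogeneous_system_solution (K : fieldType) (T Y : finType)
    (A : T -> Y -> K) : (#|Y| < #|T|)%N ->
  exists2 v : T -> K, exists t, v t != 0 & forall y, \sum_t v t * A t y = 0.
Proof.
move=> ltYT; pose B := \matrix_(i < #|T|, j < #|Y|) A (enum_val i) (enum_val j).
have /rowV0Pn[u /sub_kermxP uB u0] : kermx B != 0.
  rewrite -mxrank_eq0 mxrank_ker subn_eq0 -ltnNge.
  by apply: leq_ltn_trans (rank_leq_col B) ltYT.
have /rV0Pn[i ui] := u0.
exists (fun t => u 0 (enum_rank t)); first by exists (enum_val i); rewrite enum_valK.
move=> y; have /matrixP /(_ 0 (enum_rank y)) := uB.
rewrite !mxE => E; rewrite -[RHS]E (reindex _ (onW_bij _ (@enum_val_bij T))) /=.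
by apply: eq_bigr => j _; rewrite !mxE enum_valK enum_rankK.
Qed.

Lemma multiplicities_lt_size (K : fieldType) (P : {poly K}) (M : nat) (zs : seq K) :
  P != 0 -> uniq zs -> (forall z, z \in zs -> ('X - z%:P) ^+ M %| P) ->
  (M * size zs < size P)%N.
Proof.
move=> P0 uzs dvdP.
suff dv : \prod_(z <- zs) ('X - z%:P) ^+ M %| P.
  apply: leq_trans (dvdp_leq P0 dv).
  set q := \prod_(z <- zs) _; have q0 : q != 0.
    by rewrite prodf_seq_neq0; apply/allP => z _; rewrite expf_neq0 ?polyXsubC_eq0.
  rewrite -(prednK (_ : 0 < size q)%N) ?size_poly_gt0 // ltnS.
  by rewrite /q prodrXl size_exp size_prod_XsubC /= mulnC.
elim: zs uzs dvdP => [|z zs IH] /=; first by rewrite big_nil dvd1p.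
case/andP=> zNzs uzs dvdP; rewrite big_cons Gauss_dvdp; last first.
  rewrite prodrXl coprimep_expl // coprimep_expr //.
  by rewrite coprimep_sym coprimep_XsubC root_prod_XsubC.
by rewrite dvdP ?mem_head // IH // => w wzs; rewrite dvdP // inE wzs orbT.
Qed.

(** Orders of vanishing are read from the expansion of P(z + cX) instead of derivatives, which would
    lose information in characteristic [p]. The scale [c] will be g(z). *)
Lemma dvdp_XsubC_taylor (K : fieldType) (P : {poly K}) (z c : K) (M : nat) :
  c != 0 -> 'X^M %| P \Po (z%:P + c *: 'X) -> ('X - z%:P) ^+ M %| P.
Proof.
move=> c0 /(dvdp_comp_poly (c^-1 *: ('X - z%:P))).
rewrite -comp_polyA comp_polyD comp_polyC comp_polyZ comp_polyX scalerA divff //.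
rewrite scale1r [z%:P + _]addrC subrK comp_polyXr comp_Xn_poly exprZn.
by rewrite dvdpZl ?expf_neq0 ?invr_eq0.
Qed.

(** The term of lowest order at 0 with nonzero coefficient cannot be cancelled. This settles the
    delicate point of Stepanov's method, that the auxiliary polynomial is not zero, and is the
    reason for requiring that g have a simple zero at 0. *)
Lemma sum_distinct_order_neq0 (K : fieldType) (T : finType) (v : T -> K)
    (ord : T -> nat) (u0 : T -> {poly K}) :
  injective ord -> (forall t, (u0 t).[0] != 0) -> (exists t, v t != 0) ->
  \sum_t v t *: ('X^(ord t) * u0 t) != 0.
Proof.
move=> oI u00 [t0 vt0]; case: (@arg_minnP T t0 (fun t => v t != 0) ord vt0) => t vt tmin.
apply/eqP => /(congr1 (fun q : {poly K} => q`_(ord t))); apply/eqP.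
rewrite coef0 coef_sum (bigD1 t) //= big1 ?addr0.
  by rewrite coefZ coefXnM ltnn subnn -horner_coef0 mulf_neq0.
move=> t' t't; rewrite coefZ coefXnM.
have [->|vt'] := eqVneq (v t') 0; first by rewrite mul0r.
have := tmin t' vt'; rewrite leq_eqVlt => /predU1P[/oI tt'|->]; last by rewrite mulr0.
by rewrite tt' eqxx in t't.
Qed.

(** Degree in X where each power of Y is allowed [e] more. Weight 0 is stable under powers, so high
    powers of [unit_part] do not increase the number of linear conditions. *)
Definition weight_le (K : nzRingType) (e w : nat) (B : {poly {poly K}}) :=
  forall l, (size (B`_l)%R <= (w + l * e).+1)%N.

Lemma weight_leM (K : nzRingType) e w1 w2 (B C : {poly {poly K}}) :
  weight_le e w1 B -> weight_le e w2 C -> weight_le e (w1 + w2) (B * C).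
Proof.
move=> hB hC l; rewrite coefM; apply: leq_trans (size_sum _ _ _) _.
apply/bigmax_leqP => j _; apply: leq_trans (size_polyMleq _ _) _.
have := hB j; have := hC (l - j)%N; have := ltn_ord j.
move: (size _) (size _) => x y; nia.
Qed.

Lemma weight_leX (K : nzRingType) e w (B : {poly {poly K}}) n :
  weight_le e w B -> weight_le e (n * w) (B ^+ n).
Proof.
move=> hB; elim: n => [|n IH]; last by rewrite exprS mulSn; apply: weight_leM.
move=> l; rewrite expr0 coef1; apply: (@leq_trans 1%N) => //.
by case: (l == 0)%N; rewrite ?size_poly0 ?size_poly1.
Qed.

(** The left side counts equations and the right side unknowns. Since s q = M - 1, the right side is
    (q + 2e + 4)(M^2 - 1), and q < M leaves enough room. *)
Lemma stepanov_count s q e M : (M = s * q + 1 -> 3 <= M -> 0 < s ->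
  M * (q * M.+1 + (q + 2 * e + 4) + M * e) < s * (q + 2 * e + 4) * (q * M.+1))%N.
Proof.
move=> Mq M3 s0.
have qM : (q < M)%N by rewrite Mq addn1 ltnS leq_pmull.
have -> : (s * (q + 2 * e + 4) * (q * M.+1) = (q + 2 * e + 4) * ((s * q) * M.+1))%N by ring.
have [N MN] : exists N, M = N.+1 by exists (s * q)%N; lia.
have -> : (s * q = N)%N by lia.
rewrite MN in M3 qM *; clear Mq MN.
have h1 : (q * N <= N * N)%N by rewrite leq_mul2r; lia.
have h2 : (2 * N <= N * N)%N by rewrite leq_mul2r; lia.
have h3 : (2 * N * e <= N * N * e)%N by rewrite leq_mul2r h2 orbT.
have h4 : (2 * e <= N * e)%N by rewrite leq_mul2r; lia.
lia.
Qed.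
(** Uniqueness of a mixed-radix expansion: s D = Q - 1 forces a + D i < Q, so [k] is the quotient by
    [Q] and then [i] the quotient by [D]. *)
Lemma stepanov_ord D s Q a i k a' i' k' : ((s * D).+1 = Q -> a < D -> a' < D -> i < s -> i' < s ->
  a + Q * k + D * i = a' + Q * k' + D * i' -> [/\ k = k', i = i' & a = a'])%N.
Proof.
move=> sD aD a'D is_ i's E.
have h x y : (x < D -> y < s -> x + D * y < Q)%N.
  move=> xD ys; have : (D * y + D <= s * D)%N by rewrite -mulnSr mulnC leq_mul2r ys orbT.
  lia.
have hk : k = k'.
  have e1 := h _ _ aD is_; have e2 := h _ _ a'D i's.
  have d1 : ((a + D * i + k * Q) %/ Q = k)%N by rewrite addnC divnMDl ?divn_small ?addn0 //; lia.
  have d2 : ((a' + D * i' + k' * Q) %/ Q = k')%N by rewrite addnC divnMDl ?divn_small ?addn0 //; lia.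
  by rewrite -d1 -d2; congr (_ %/ _)%N; lia.
have E2 : (a + i * D = a' + i' * D)%N by move: E; rewrite hk; lia.
have hi : i = i'.
  have d1 : ((a + i * D) %/ D = i)%N by rewrite addnC divnMDl ?divn_small ?addn0 //; lia.
  have d2 : ((a' + i' * D) %/ D = i')%N by rewrite addnC divnMDl ?divn_small ?addn0 //; lia.
  by rewrite -d1 -d2 E2.
by split => //; move: E2; rewrite hi; lia.
Qed.
Lemma stepanov_degree D s Q e a i k kap x y : ((s * D).+1 = Q -> a < D -> i < s -> k < kap ->
  y <= e -> x <= (y.-1 * (D * i)).+1 ->
  ((a + Q * k + D * i).+1 + x).-1 <= Q * (kap + e))%N.
Proof.
move=> sD aD is_ kk ye xle.
have h1 : (D * i + D <= s * D)%N by rewrite -mulnSr mulnC leq_mul2r is_ orbT.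
have h2 : (Q * k + Q <= Q * kap)%N by rewrite -mulnSr leq_mul2l kk orbT.
have h3 : (y.-1 * (D * i) <= e * Q)%N by apply: leq_mul; lia.
lia.
Qed.

Section Stepanov.
Variables (K : fieldType) (p : nat) (pK : p \in [pchar K]).
Variables (g g0 : {poly K}) (e : nat).
Hypotheses (gE : g = 'X * g0) (g00 : g0.[0] != 0) (size_g : (size g <= e.+1)%N).

(* [g.[X + g Y] = g * unit_part], as polynomials in [Y] over [K[X]]. *)
Definition unit_part : {poly {poly K}} :=
  1 + \sum_(l < size g) (g^`N(l.+1) * g ^+ l)%:P * 'X^(l.+1).

Lemma weight_unit_part : weight_le e 0 unit_part.
Proof.
move=> l; rewrite coefD coef1 coef_sum; apply: leq_trans (size_polyD _ _) _.
rewrite geq_max; apply/andP; split.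
  by case: (l == 0)%N; rewrite ?size_poly0 ?size_poly1.
apply: leq_trans (size_sum _ _ _) _; apply/bigmax_leqP => j _.
rewrite coefCM coefXn; case: eqP => [->|_]; last by rewrite mulr0 size_poly0.
rewrite mulr1 mulSn; apply: leq_trans (size_polyMleq _ _) _.
have h1 : (size g^`N(j.+1) <= e)%N.
  apply: leq_trans (size_poly _ _) _; have := size_g; lia.
have h2 : (size (g ^+ j) <= (e * j).+1)%N.
  apply: leq_trans (size_poly_exp_leq _ _) _; rewrite ltnS leq_mul2r.
  by apply/orP; right; have := size_g; lia.
by move: h1 h2; move: (size _) (size _) => x y; nia.
Qed.

(** With the increment scaled by g(z), every Taylor term has a factor g(z). What remains after
    removing it is polynomial in z, with no negative powers of g(z). *)
Lemma unit_part_taylor z :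
  g \Po (z%:P + g.[z] *: 'X) = g.[z] *: map_poly (horner_eval z) unit_part.
Proof.
have -> : g \Po (z%:P + g.[z] *: 'X) =
    \sum_(i < (size g).+1) (g^`N(i).[z])%:P * (g.[z] *: 'X) ^+ i.
  rewrite /comp_poly (nderiv_taylor _ (mulrC _ _)) big_ord_recr /=.
  rewrite [g^`N(size g)]nderivn_poly0 // horner0 mul0r addr0.
  rewrite size_map_inj_poly ?rmorph0 //; last exact: polyC_inj.
  by apply: eq_bigr => i _; rewrite nderivn_map horner_map.
rewrite big_ord_recl expr0 mulr1 nderivn0 /unit_part rmorphD rmorph1 /= scalerDr.
congr (_ + _); first by rewrite -mul_polyC mulr1.
rewrite rmorph_sum /= scaler_sumr; apply: eq_bigr => i _.
rewrite rmorphM /= map_polyC /= map_polyXn horner_evalE hornerM horner_exp.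
rewrite exprZn /bump add1n -!mul_polyC !polyCM !polyC_exp !exprS.
by ring.
Qed.

Lemma coef_XnQ_exp (c : K) (H S : {poly K}) Q k l : (l < Q)%N ->
  ((c%:P + 'X^Q * S) ^+ k * H)`_l = c ^+ k * H`_l.
Proof.
move=> lQ; elim: k => [|k IH]; first by rewrite !expr0 !mul1r.
rewrite exprS -mulrA mulrDl coefD coefCM IH -mulrA coefXnM lQ addr0.
by rewrite exprS mulrA.
Qed.

(** The auxiliary polynomial P combines the products X^a X^(Qk) g^(Di) with Q = M^2 and D = (Q -
    1)/s. At the points considered, X^Q behaves like z and g^D like [zeta], so the first M Taylor
    coefficients of P are polynomials in z of small degree. Linear algebra makes them vanish
    identically; P then has a zero of order M at each point, and its degree is below Q(q + 3e +
    4). *)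
Theorem stepanov_bound (m s q : nat) (zeta : K) (zs : seq K) :
  (p ^ m = s * q + 1)%N -> (3 <= p ^ m)%N -> (0 < s)%N -> zeta != 0 ->
  uniq zs ->
  (forall z, z \in zs ->
     z ^+ ((p ^ m) ^ 2)%N = z /\ g.[z] ^+ (q * (p ^ m).+1) = zeta) ->
  (size zs <= (q + 3 * e + 4) * p ^ m)%N.
Proof.
set M := (p ^ m)%N => Mq M3 s0 z0 uzs hzs.
pose Q := (M ^ 2)%N; pose D := (q * M.+1)%N.
have sD : (s * D).+1 = Q.
  have E : (s * q = M.-1)%N by rewrite Mq addn1.
  by rewrite /D /Q mulnA E -mulnn; case: (M) M3 => // n _; rewrite /=; lia.
have q_gt0 : (0 < q)%N by case: (q) Mq M3 => // ->; rewrite muln0.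
(* [kap] is chosen for [stepanov_count]. [W] exceeds the degree k + a + l e of every Taylor
   coefficient met below, as k < kap, a < D and l < M. *)
pose kap := (q + 2 * e + 4)%N; pose W := (D + kap + M * e)%N.
pose T : finType := ('I_s * 'I_kap * 'I_D)%type.
pose Y : finType := ('I_M * 'I_W)%type.
pose B (a i : nat) : {poly {poly K}} :=
  ('X%:P + g%:P * 'X) ^+ a * unit_part ^+ (D * i).
(* The contribution of one product to the coefficient of Y^l X^w, after X^(Qk) has become X^k and
   g^(Di) has become [zeta ^+ i] times a power of [unit_part]. *)
pose A (t : T) (y : Y) := zeta ^+ t.1.1 * ('X^(t.1.2) * (B t.2 t.1.1)`_y.1)`_y.2.
have cardlt : (#|Y| < #|T|)%N.
  by rewrite !card_prod !card_ord; apply: stepanov_count.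
have [v v0 vA] := homogeneous_system_solution A cardlt.
(* The order at 0 of the product indexed by [t], because g is X times a polynomial that does not
   vanish at 0. *)
pose ord (t : T) : nat := (t.2 + Q * t.1.2 + D * t.1.1)%N.
have ordI : injective ord.
  move=> [[i k] a] [[i' k'] a']; rewrite /ord /=.
  case/(stepanov_ord sD (ltn_ord a) (ltn_ord a') (ltn_ord i) (ltn_ord i')) => hk hi ha.
  by rewrite (val_inj hk) (val_inj hi) (val_inj ha).
pose u t : {poly K} := 'X^(ord t) * g0 ^+ (D * t.1.1).
pose P := \sum_t v t *: u t.
have P0 : P != 0.
  by apply: sum_distinct_order_neq0 => // t; rewrite horner_exp expf_neq0.
have sizeP : (size P <= Q * (kap + e))%N.
  apply: leq_trans (size_sum _ _ _) _; apply/bigmax_leqP => -[[i k] a] _.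
  apply: leq_trans (size_scale_leq _ _) _; rewrite /u /ord /=.
  apply: leq_trans (size_polyMleq _ _) _; rewrite size_polyXn.
  have g0N : g0 != 0 by apply: contraNneq g00 => ->; rewrite horner0.
  have sg0 : (size g0 <= e)%N by have := size_g; rewrite gE mulrC size_mulX.
  by apply: stepanov_degree sD (ltn_ord a) (ltn_ord i) (ltn_ord k) sg0 (size_poly_exp_leq _ _).
rewrite leqNgt; apply/negP => big.
have := multiplicities_lt_size P0 uzs (M := M).
suff dvdP z : z \in zs -> ('X - z%:P) ^+ M %| P.
  move/(_ dvdP); rewrite ltnNge; move/negP; apply.
  apply: leq_trans sizeP _; rewrite /Q -mulnn -mulnA leq_mul2l; apply/orP; right.
  apply: leq_trans (ltnW big); rewrite mulnC leq_mul2r; apply/orP; right.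
  by rewrite /kap; lia.
move=> zzs; have [zQ gz] := hzs z zzs.
have gz0 : g.[z] != 0.
  apply: contraNneq z0 => g0'; move: gz; rewrite g0' expr0n => <-.
  by rewrite muln_eq0 -leqn0 leqNgt q_gt0.
apply: (dvdp_XsubC_taylor gz0); set L := _ + _.
(* Q is a power of [p] and z^Q = z, so L^Q is the constant z up to order Q, hence up to order M. *)
have LQ : L ^+ Q = z%:P + 'X^Q * (g.[z] ^+ Q)%:P.
  rewrite exprDn_pchar; last first.
    by rewrite /Q /M -expnM pnatX pnatE ?(pcharf_prime pK) // pchar_poly pK.
  by rewrite -rmorphXn /= (zQ : z ^+ Q = z) exprZn -mul_polyC mulrC.
have MQ : (M <= Q)%N by rewrite /Q -mulnn leq_pmulr //; lia.
have mapL : map_poly (horner_eval z) ('X%:P + g%:P * 'X) = L.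
  rewrite rmorphD rmorphM /= !map_polyC map_polyX /=.
  by rewrite !horner_evalE hornerX mul_polyC.
have uL t : u t \Po L =
    zeta ^+ t.1.1 *: (L ^+ Q ^+ t.1.2 * map_poly (horner_eval z) (B t.2 t.1.1)).
  case: t => [[i k] a]; have -> : u (i, k, a) = 'X^(a + Q * k) * g ^+ (D * i).
    by rewrite /u /ord /= gE exprMn exprD mulrA.
  rewrite rmorphM !rmorphXn /= comp_polyX unit_part_taylor -/L exprZn exprM (gz : _ ^+ D = _).
  by rewrite /B rmorphM !rmorphXn /= mapL exprD exprM -!scalerAr mulrA [L ^+ a * _]mulrC.
rewrite -(poly_take_drop M (P \Po L)).
suff -> : take_poly M (P \Po L) = 0 by rewrite add0r dvdp_mulIr.
apply/polyP => l; rewrite coef_take_poly coef0; case: ifP => // lM.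
have -> : (P \Po L)`_l =
    (\sum_t v t *: (zeta ^+ t.1.1 *: ('X^(t.1.2) * (B t.2 t.1.1)`_l))).[z].
  rewrite rmorph_sum /= coef_sum horner_sum; apply: eq_bigr => t _.
  rewrite linearZ /= uL !coefZ !hornerZ LQ coef_XnQ_exp ?(leq_trans lM) //.
  by rewrite hornerM hornerXn coef_map /= horner_evalE.
(* C no longer involves z. Its coefficients below [W] vanish by the choice of [v], the others for
   reasons of weight. *)
set C := \sum_t _; suff -> : C = 0 by rewrite horner0.
apply/polyP => w; rewrite coef0 coef_sum; have [wW|Ww] := ltnP w W.
  rewrite -[RHS](vA (Ordinal lM, Ordinal wW)); apply: eq_bigr => t _.
  by rewrite !coefZ.
rewrite big1 // => -[[i k] a] _ /=; rewrite !coefZ coefXnM; case: ifP => wk.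
  by rewrite !mulr0.
rewrite nth_default ?mulr0 //.
have wB : weight_le e a (B a i).
  rewrite -[X in weight_le _ X]addn0; apply: weight_leM.
    rewrite -[X in weight_le _ X]muln1; apply: weight_leX => j.
    rewrite coefD coefC coefCM coefX; case: j => [|[|j]] /=.
    - by rewrite mulr0 addr0 size_polyX.
    - by rewrite add0r mulr1 (leq_trans size_g) // mul1n; lia.
    - by rewrite mulr0 addr0 size_poly0.
  by rewrite -[X in weight_le _ X](muln0 (D * i)); apply/weight_leX/weight_unit_part.
apply: leq_trans (wB l) _; have := ltn_ord a; have := ltn_ord k.
have : (l * e <= M * e)%N by rewrite leq_mul2r ltnW ?orbT.
by move: Ww wk; rewrite /W; lia.
Qed.
End Stepanov.

(** * Frobenius orbits in the algebraic closure *)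

Section AlgebraicClosure.
Variables (p : nat) (p_pr : prime p) (K : closedFieldType).
Variable (emb : {rmorphism 'F_p -> K}).

Lemma pchar_closure : p \in [pchar K].
Proof. exact: (rmorph_pchar emb (pchar_Fp p_pr)). Qed.

Lemma frobeniusB (R : comNzRingType) (x y : R) n : p \in [pchar R] ->
  (x - y) ^+ (p ^ n) = x ^+ (p ^ n) - y ^+ (p ^ n).
Proof.
move=> pR; have np : [pchar R].-nat (p ^ n)%N by rewrite pnatX pnatE // pR.
by rewrite exprDn_pchar // exprNn_pchar.
Qed.

Lemma prime_exp_gt1 n : (0 < n)%N -> (1 < p ^ n)%N.
Proof. by move=> n0; rewrite -(expn0 p) ltn_exp2l // prime_gt1. Qed.

Lemma frobenius_inj n : injective (fun x : K => x ^+ (p ^ n)).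
Proof.
move=> x y /eqP; rewrite -subr_eq0 -frobeniusB ?pchar_closure // expf_eq0.
by rewrite subr_eq0 => /andP[_ /eqP].
Qed.

(** For n > 0 this lists the subfield of K with p^n elements. *)
Definition fixed_points n : seq K :=
  sval (closed_field_poly_normal ('X^(p ^ n) - 'X)).

Lemma fixed_points_spec n : (0 < n)%N ->
  'X^(p ^ n) - 'X = \prod_(z <- fixed_points n) ('X - z%:P) :> {poly K}.
Proof.
move=> n0; rewrite /fixed_points; case: closed_field_poly_normal => r /= {1}->.
rewrite lead_coefDl ?lead_coefXn ?scale1r // size_polyN size_polyX size_polyXn.
by rewrite ltnS prime_exp_gt1.
Qed.

Lemma mem_fixed_points n x : (0 < n)%N ->
  (x \in fixed_points n) = (x ^+ (p ^ n) == x).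
Proof.
move=> n0; rewrite -root_prod_XsubC -fixed_points_spec // rootE.
by rewrite !hornerE ?hornerXn subr_eq0.
Qed.

Lemma size_fixed_points n : (0 < n)%N -> size (fixed_points n) = (p ^ n)%N.
Proof.
move=> n0; apply: succn_inj; rewrite -(size_prod_XsubC _ id) -fixed_points_spec //.
rewrite size_polyDl ?size_polyXn // size_polyN size_polyX.
by rewrite ltnS prime_exp_gt1.
Qed.

Lemma uniq_fixed_points n : (0 < n)%N -> uniq (fixed_points n).
Proof.
move=> n0; rewrite -separable_prod_XsubC -fixed_points_spec //.
rewrite unlock derivB derivXn derivX -mulr_natr natrX.
have := pchar_closure => /andP[_ /eqP pK0].
have pX0 : p%:R = 0 :> {poly K} by rewrite -polyC_natr pK0.
rewrite pX0 expr0n -leqn0 leqNgt n0 mulr0 sub0r.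
rewrite (_ : - 1 = (- 1) *: 1); last by rewrite scaleN1r.
rewrite coprimepZr ?coprimep1 //.
by rewrite oppr_eq0 oner_eq0.
Qed.

Lemma frobenius_fixed x : x ^+ p = x -> exists a, emb a = x.
Proof.
move=> xp; have := congr1 (map_poly emb) (finField_genPoly 'F_p).
rewrite rmorphB rmorphXn /= map_polyX card_Fp // rmorph_prod /=.
move/(congr1 (fun q => q.[x])); rewrite !hornerE ?hornerXn xp subrr horner_prod.
move/esym/eqP/prodf_eq0 => [a _].
by rewrite rmorphB /= map_polyX map_polyC /= !hornerE subr_eq0 => /eqP ->; exists a.
Qed.

Definition descent (x : K) : 'F_p := odflt 0 [pick a | emb a == x].

Lemma descentK x : x ^+ p = x -> emb (descent x) = x.
Proof.
case/frobenius_fixed => a <-; rewrite /descent; case: pickP => [b /eqP //|].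
by move/(_ a); rewrite eqxx.
Qed.

Lemma embK : cancel emb descent.
Proof.
move=> a; apply: (fmorph_inj emb); rewrite descentK // -rmorphXn.
by have := expf_card a; rewrite card_Fp // => ->.
Qed.

(** For x in the field with p^n elements this is the characteristic polynomial of x over ['F_p], a
    power of the minimal polynomial. It encodes both norms and the trace. *)
Definition orbit_poly n x : {poly K} := \prod_(i < n) ('X - (x ^+ (p ^ i))%:P).

Lemma orbit_poly_frobenius n x : x ^+ (p ^ n) = x ->
  \prod_(i < n) ('X - (x ^+ (p ^ i.+1))%:P) = orbit_poly n x.
Proof.
case: n => [|n] xn; first by rewrite /orbit_poly !big_ord0.
rewrite /orbit_poly big_ord_recr big_ord_recl /= xn expn0 expr1 mulrC.
by congr (_ * _); apply: eq_bigr => i _.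
Qed.

(** Frobenius permutes the conjugates cyclically, hence fixes every coefficient, and its fixed
    points are the image of [emb]. *)
Lemma orbit_poly_descent n x : x ^+ (p ^ n) = x ->
  map_poly emb (map_poly descent (orbit_poly n x)) = orbit_poly n x.
Proof.
move=> xn; apply/polyP => k.
have d0 : descent 0 = 0 by rewrite -(rmorph0 emb) embK.
rewrite coef_map /= coef_map_id0 // descentK //.
rewrite -(pFrobenius_autE pchar_closure) -coef_map /=.
suff -> : map_poly (pFrobenius_aut pchar_closure) (orbit_poly n x) = orbit_poly n x by [].
rewrite -[RHS]orbit_poly_frobenius // /orbit_poly rmorph_prod /=.
apply: eq_bigr => i _.
by rewrite rmorphB /= map_polyX map_polyC /= pFrobenius_autE -exprM -expnSr.
Qed.

Lemma orbit_poly_monic n x : orbit_poly n x \is monic.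
Proof. by apply: monic_prod => i _; apply: monicXsubC. Qed.

Lemma size_orbit_poly n x : size (orbit_poly n x) = n.+1.
Proof.
rewrite /orbit_poly (size_prod_XsubC _ (fun i : 'I_n => x ^+ (p ^ i))).
by rewrite /index_enum -enumT size_enum_ord.
Qed.

Lemma orbit_polyD m n x : x ^+ (p ^ m) = x ->
  orbit_poly (m + n) x = orbit_poly m x * orbit_poly n x.
Proof.
move=> xm; rewrite /orbit_poly big_split_ord /=; congr (_ * _).
by apply: eq_bigr => i _; rewrite expnD exprM xm.
Qed.

Lemma root_orbit_poly n x : (0 < n)%N -> root (orbit_poly n x) x.
Proof.
case: n => // n _; rewrite /orbit_poly big_ord_recl expn0 expr1 rootM.
by rewrite root_XsubC eqxx.
Qed.

Lemma root_of_dvdp (L : fieldType) (q r : {poly L}) x :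
  q %| r -> root q x -> root r x.
Proof. by move=> qr; rewrite -!dvdp_XsubCl => /dvdp_trans; apply. Qed.

Lemma root_frobenius (g : {poly 'F_p}) x i :
  root (map_poly emb g) x -> root (map_poly emb g) (x ^+ (p ^ i)).
Proof.
move=> gx; elim: i => [|i IH]; first by rewrite expn0 expr1.
rewrite expnSr exprM; move: (x ^+ _) IH => {gx}x gx.
have -> : map_poly emb g = map_poly (pFrobenius_aut pchar_closure) (map_poly emb g).
  apply/polyP => k; rewrite !coef_map /= pFrobenius_autE -rmorphXn.
  by have := expf_card g`_k; rewrite card_Fp // => ->.
rewrite rootE -(pFrobenius_autE pchar_closure) horner_map /=.
by rewrite (eqP gx) pFrobenius_aut0.
Qed.

(** All conjugates are roots of g, so two of them coincide; injectivity of Frobenius moves the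
    coincidence back to x itself. *)
Lemma frobenius_period (g : {poly 'F_p}) x : g != 0 -> root (map_poly emb g) x ->
  exists m, [/\ (0 < m)%N, x ^+ (p ^ m) = x &
    forall i, (0 < i < m)%N -> x ^+ (p ^ i) != x].
Proof.
move=> g0 gx; have exm : exists m, (0 < m)%N && (x ^+ (p ^ m) == x).
  pose s := mkseq (fun i => x ^+ (p ^ i)) (size g).
  have : ~~ uniq s.
    apply/negP => us; have := @max_poly_roots _ (map_poly emb g) s.
    rewrite map_poly_eq0 g0 us size_map_poly size_mkseq ltnn.
    suff -> : all (root (map_poly emb g)) s by move/(_ isT isT isT).
    by apply/allP => y /mapP[i _ ->]; apply: root_frobenius.
  case/(uniqPn 0) => i [j [ij]]; rewrite size_mkseq => js.
  rewrite !nth_mkseq ?(ltn_trans ij) // => E.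
  exists (j - i)%N; rewrite subn_gt0 ij; apply/eqP/(@frobenius_inj i) => /=.
  by rewrite -exprM -expnD subnK // ltnW.
case: (ex_minnP exm) => k /andP[k0 /eqP kx] kmin.
exists k; split => // i /andP[i0 ik]; apply/negP => xi.
by have := kmin i; rewrite i0 xi => /(_ isT); rewrite leqNgt ik.
Qed.

Lemma prod_XsubC_mup (L : fieldType) (r : seq L) x :
  mup x (\prod_(z <- r) ('X - z%:P)) = count_mem x r.
Proof.
elim: r => [|z r IH] /=; first by rewrite big_nil mupNroot // root1.
rewrite big_cons mupM ?polyXsubC_eq0 ?IH //; first by rewrite -['X - _]expr1 mup_XsubCX; case: eqP.
by rewrite prodf_seq_neq0; apply/allP => w _; rewrite polyXsubC_eq0.
Qed.

(** If x has degree m, the admissible [j] are the multiples m r, and [orbit_poly] is then the r-th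
    power of the minimal polynomial; it divides g exactly when r is at most the multiplicity of x.
    The induction removes one copy of the minimal polynomial. *)
Lemma orbit_poly_count x n (g : {poly 'F_p}) : g \is monic -> size g = n.+1 ->
  (\sum_(1 <= j < n.+1)
     ((x ^+ (p ^ j) == x)%R && (orbit_poly j x %| map_poly emb g)%R : nat) =
   mup x (map_poly emb g))%N.
Proof.
elim/ltn_ind: n g => n IH g mg sg; have g0 := monic_neq0 mg.
have [gx|gx] := boolP (root (map_poly emb g) x); last first.
  rewrite mupNroot // big_nat big1 // => j /andP[j0 _]; apply/eqP.
  rewrite eqb0; apply: contra gx => /andP[_ /root_of_dvdp]; apply.
  exact: root_orbit_poly.
have [m [m0 xm mmin]] := frobenius_period g0 gx.
have um : uniq (mkseq (fun i => x ^+ (p ^ i)) m).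
  apply/(mkseq_uniqP) => i j; rewrite !inE.
  wlog ij : i j / (i <= j)%N.
    by move=> H im jm E; case/orP: (leq_total i j) => h; [|apply/esym]; apply: H.
  move=> im jm; rewrite -(subnK ij) expnD exprM => /(@frobenius_inj i) /esym /eqP.
  have [-> //|ji] := eqVneq (j - i)%N 0%N.
  by rewrite (negPf (mmin _ _)) // lt0n ji (leq_ltn_trans (leq_subr _ _)).
have opE : orbit_poly m x = \prod_(z <- mkseq (fun i => x ^+ (p ^ i)) m) ('X - z%:P).
  rewrite /orbit_poly -(big_mkord xpredT (fun i => 'X - (x ^+ (p ^ i))%:P)).
  by rewrite big_map /index_iota subn0.
have dm : orbit_poly m x %| map_poly emb g.
  rewrite opE uniq_roots_dvdp ?uniq_rootsE //.
  by apply/allP => y /mapP[i _ ->]; apply: root_frobenius.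
move: dm; rewrite -(orbit_poly_descent xm) dvdp_map; set o := map_poly descent _.
case/dvdpP => h gE.
have oE : map_poly emb o = orbit_poly m x by apply: orbit_poly_descent.
have mo : o \is monic by rewrite -(map_monic emb) oE orbit_poly_monic.
have so : size o = m.+1 by rewrite -(size_map_poly emb) oE size_orbit_poly.
have mh : h \is monic by rewrite -(monicMr h mo) -gE.
have h0 := monic_neq0 mh.
have sh : size h = (n - m).+1 /\ (m <= n)%N.
  have : (0 < size h)%N by rewrite size_poly_gt0.
  by move: sg; rewrite gE size_Mmonic // so; move: (size h) => k; split; lia.
have [{}sh mn] := sh.
have ghE : map_poly emb g = orbit_poly m x * map_poly emb h.
  by rewrite gE rmorphM /= oE mulrC.
rewrite ghE mupM ?map_poly_eq0 ?(monic_neq0 (orbit_poly_monic _ _)) //.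
have -> : mup x (orbit_poly m x) = 1%N.
  rewrite opE prod_XsubC_mup count_uniq_mem //.
  by rewrite (_ : x \in _) //; apply/mapP; exists 0%N; rewrite ?mem_iota ?expr1.
rewrite -(IH (n - m)%N) //; last by lia.
rewrite (@big_cat_nat _ _ _ m) //=; last by lia.
rewrite big_nat big1 ?add0n; last first.
  by move=> i im; rewrite (negPf (mmin i im)).
rewrite big_ltn // -ghE xm eqxx ghE dvdp_mulr //=; congr (_ + _)%N.
rewrite -{1}(subnK mn) -addSn -{1}[m.+1]add1n big_addn addnK.
apply: eq_bigr => j _; rewrite addnC orbit_polyD // expnD exprM xm.
by rewrite dvdp_mul2l ?(monic_neq0 (orbit_poly_monic _ _)).
Qed.

(** The function field analogue of the identity that the von Mangoldt function, summed over the
    divisors of an integer, gives its logarithm. *)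
Lemma orbit_poly_total n (g : {poly 'F_p}) : g \is monic -> size g = n.+1 ->
  (\sum_(1 <= j < n.+1)
     \sum_(x <- fixed_points j) ((orbit_poly j x %| map_poly emb g)%R : nat) = n)%N.
Proof.
move=> mg sg; have [r rE] := closed_field_poly_normal (map_poly emb g).
rewrite lead_coef_map (monicP mg) rmorph1 scale1r in rE.
have sr : size r = n.
  by apply: succn_inj; rewrite -(size_prod_XsubC _ id) -rE size_map_poly.
transitivity (\sum_(1 <= j < n.+1) \sum_(x <- undup r)
     ((x ^+ (p ^ j) == x)%R && (orbit_poly j x %| map_poly emb g)%R : nat))%N.
  apply: eq_big_nat => j /andP[j0 _].
  have perm : perm_eq [seq x <- fixed_points j | orbit_poly j x %| map_poly emb g]
      [seq x <- undup r | (x ^+ (p ^ j) == x) && (orbit_poly j x %| map_poly emb g)].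
    apply: uniq_perm; rewrite ?filter_uniq ?undup_uniq ?uniq_fixed_points // => x.
    rewrite !mem_filter mem_undup mem_fixed_points // andbC.
    case: (boolP (_ %| _)) => dx; rewrite ?andbF ?andbT //=.
    case: eqP => //= _; apply/esym; rewrite -root_prod_XsubC -rE.
    by apply: root_of_dvdp dx (root_orbit_poly _ _).
  by rewrite -!big_mkcond -[LHS]big_filter -[RHS]big_filter; apply: perm_big.
rewrite exchange_big /= (eq_bigr (fun x => count_mem x r)); last first.
  by move=> x _; rewrite orbit_poly_count // rE prod_XsubC_mup.
rewrite -sr; under eq_bigr => x _ do rewrite -sum1_count big_mkcond /=.
rewrite exchange_big /= -sum1_size; apply: eq_big_seq => y yr.
rewrite -big_mkcond /= (eq_bigl (pred1 y)); last by move=> x; rewrite /= eq_sym.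
by rewrite -big_filter filter_pred1_uniq ?undup_uniq ?mem_undup // big_seq1.
Qed.
End AlgebraicClosure.

(** * L-functions and Newton's identities *)

Section MonicPolynomials.
Variable F : fieldType.

(** Row vectors of lower coefficients provide a finite type to sum over. *)
Definition monic_of n (v : 'rV[F]_n) : {poly F} := 'X^n + rVpoly v.

Lemma size_rVpoly n (v : 'rV[F]_n) : (size (rVpoly v) <= n)%N.
Proof. exact: size_poly. Qed.

Lemma size_monic_of n (v : 'rV[F]_n) : size (monic_of v) = n.+1.
Proof. by rewrite size_polyDl size_polyXn // ltnS size_rVpoly. Qed.

Lemma monic_ofP n (v : 'rV[F]_n) : monic_of v \is monic.
Proof. by rewrite monicE lead_coefDl ?lead_coefXn // size_polyXn ltnS size_rVpoly. Qed.

Lemma size_monic_subXn n (g : {poly F}) : g \is monic -> size g = n.+1 ->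
  (size (g - 'X^n)%R <= n)%N.
Proof.
move=> mg sg; apply/leq_sizeP => j; rewrite leq_eqVlt => /predU1P[<-|nj].
  by rewrite coefB coefXn eqxx; move: mg; rewrite monicE lead_coefE sg => /eqP ->; rewrite subrr.
by rewrite coefB coefXn gtn_eqF // nth_default ?subr0 // sg.
Qed.

Lemma monic_of_onto n (g : {poly F}) : g \is monic -> size g = n.+1 ->
  monic_of (poly_rV (g - 'X^n) : 'rV_n) = g.
Proof.
by move=> mg sg; rewrite /monic_of poly_rV_K ?size_monic_subXn // addrC subrK.
Qed.

Lemma monic_ofK n (v : 'rV[F]_n) : poly_rV (monic_of v - 'X^n) = v.
Proof. by rewrite /monic_of addrC addKr rVpolyK. Qed.
End MonicPolynomials.

Section EulerProduct.
Variables (p : nat) (p_pr : prime p) (K : closedFieldType).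
Variables (emb : {rmorphism 'F_p -> K}) (C : comNzRingType).
Variable Lam : {poly 'F_p} -> C.
Hypothesis LamM : forall g h, g \is monic -> h \is monic ->
  Lam (g * h) = Lam g * Lam h.

(** The n-th coefficient of the L-function attached to [Lam]. *)
Definition monic_sum n : C := \sum_(v : 'rV['F_p]_n) Lam (monic_of v).

(** The character sum over the field with p^n elements: [Lam] is evaluated at characteristic
    polynomials. *)
Definition closure_sum n : C :=
  \sum_(x <- fixed_points p K n) Lam (map_poly (descent emb) (orbit_poly p n x)).

Lemma monic_sum_multiples n j (o : {poly 'F_p}) : o \is monic -> size o = j.+1 ->
  (j <= n)%N ->
  Lam o * monic_sum (n - j) = \sum_(u : 'rV['F_p]_n | o %| monic_of u) Lam (monic_of u).
Proof.
move=> mo so jn; rewrite mulr_sumr.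
have sM (v : 'rV['F_p]_(n - j)) : size (o * monic_of v) = n.+1.
  rewrite size_Mmonic ?monic_ofP ?monic_neq0 // so size_monic_of.
  by rewrite addSn addnS /= subnKC.
rewrite (reindex_onto (fun v : 'rV_(n - j) => poly_rV (o * monic_of v - 'X^n) : 'rV_n)
  (fun u => poly_rV (monic_of u %/ o - 'X^(n - j)))) /=; last first.
  move=> u ou; have du := divpK ou.
  have md : monic_of u %/ o \is monic by rewrite -(monicMr _ mo) du monic_ofP.
  have sd : size (monic_of u %/ o) = (n - j).+1.
    by rewrite size_divp ?monic_neq0 // size_monic_of so /= subSn.
  by rewrite monic_of_onto // mulrC du monic_ofK.
apply: eq_big => [v|v _]; last by rewrite monic_of_onto ?LamM ?monicMl ?monic_ofP.
rewrite monic_of_onto ?sM ?monicMl ?monic_ofP // dvdp_mulr //=.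
by rewrite mulKp ?monic_neq0 // monic_ofK eqxx.
Qed.

(** This is T L'(T) = L(T) times the generating series of the sums S_j, read off coefficientwise.
    Writing n as the count in [orbit_poly_total] and exchanging sums proves it without an infinite
    Euler product. *)
Lemma newton_euler n :
  n%:R * monic_sum n = \sum_(1 <= j < n.+1) closure_sum j * monic_sum (n - j).
Proof.
transitivity (\sum_(1 <= j < n.+1) \sum_(x <- fixed_points p K j)
    \sum_(u : 'rV['F_p]_n) ((orbit_poly p j x %| map_poly emb (monic_of u))%R)%:R
      * Lam (monic_of u)); last first.
  apply: eq_big_nat => j /andP[j0 jn]; rewrite mulr_suml.
  apply: eq_big_seq => x; rewrite mem_fixed_points // => /eqP xj.
  set o := map_poly _ _; have oE : map_poly emb o = orbit_poly p j x.
    exact: orbit_poly_descent.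
  have mo : o \is monic by rewrite -(map_monic emb) oE orbit_poly_monic.
  have so : size o = j.+1 by rewrite -(size_map_poly emb) oE size_orbit_poly.
  rewrite (monic_sum_multiples mo so) // -oE [RHS]big_mkcond /=.
  by apply: eq_bigr => u _; rewrite dvdp_map; case: (_ %| _); rewrite ?mul1r ?mul0r.
rewrite /monic_sum mulr_sumr.
under [RHS]eq_bigr => j _ do rewrite exchange_big /=.
rewrite exchange_big /=; apply: eq_bigr => u _.
rewrite -{1}(orbit_poly_total p_pr emb (monic_ofP u) (size_monic_of u)).
rewrite natr_sum mulr_suml; apply: eq_bigr => j _.
by rewrite natr_sum mulr_suml.
Qed.
End EulerProduct.

Section NewtonIdentities.
Variable C : closedFieldType.

Lemma newton_step (f a : nat -> C) (z : C) m :
  let a' k := a k - (if k is k'.+1 then z * a k' else 0) in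
  \sum_(1 <= j < m.+2) f j * a' (m.+1 - j)%N =
  \sum_(1 <= j < m.+2) f j * a (m.+1 - j)%N
    - z * \sum_(1 <= j < m.+1) f j * a (m - j)%N.
Proof.
move=> a'; rewrite /a' !big_add1 /= !big_mkord !big_ord_recr /= !subnn !subr0.
rewrite mulr_sumr addrAC -sumrB; congr (_ + _); apply: eq_bigr => j _.
have -> : (m.+1 - j.+1 = (m - j.+1).+1)%N by rewrite subSn.
by ring.
Qed.

Lemma newton_prod (w : seq C) n :
  let A := \prod_(z <- w) (1 - z *: 'X) in
  n%:R * A`_n = - \sum_(1 <= j < n.+1) (\sum_(z <- w) z ^+ j) * A`_(n - j).
Proof.
elim: w n => [|z w IH] n /=.
  rewrite big_nil coef1; case: n => [|n]; first by rewrite mul0r big_geq // oppr0.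
  by rewrite mulr0 big1 ?oppr0 // => j _; rewrite big_nil mul0r.
case: n => [|m]; first by rewrite mul0r big_geq // oppr0.
rewrite big_cons; set A := \prod_(z <- w) _ in IH *.
have cE k : ((1 - z *: 'X) * A)`_k = A`_k - (if k is k'.+1 then z * A`_k' else 0).
  rewrite mulrBl mul1r -scalerAl coefB coefZ coefXM; case: k => //=.
  by rewrite mulr0.
under eq_bigr => j _ do rewrite cE big_cons.
rewrite cE (newton_step _ (fun k => A`_k)) opprB.
have splitE n (b : nat -> C) :
    \sum_(1 <= j < n) (z ^+ j + \sum_(y <- w) y ^+ j) * b j =
    \sum_(1 <= j < n) z ^+ j * b j + \sum_(1 <= j < n) (\sum_(y <- w) y ^+ j) * b j.
  by rewrite -big_split; apply: eq_bigr => j _; rewrite mulrDl.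
rewrite !splitE mulrBr IH.
have -> : m.+1%:R * (z * A`_m) = z * A`_m + z * (m%:R * A`_m).
  by rewrite -[m.+1]addn1 natrD; ring.
rewrite IH [\sum_(1 <= i < m.+2) z ^+ i * _](_ : _ =
  z * A`_m + z * \sum_(1 <= i < m.+1) z ^+ i * A`_(m - i)); first by ring.
rewrite big_ltn // expr1 subn1 /=; congr (_ + _).
rewrite mulr_sumr big_add1 /=; apply: eq_big_nat => j _.
by rewrite subSS exprS mulrA.
Qed.

(** The polynomial with coefficients [A] has constant term 1, so it factors through its reciprocal
    roots. Their negated power sums obey the same recurrence as [S], and A 0 = 1 lets the recurrence
    determine each term from the previous ones. *)
Lemma power_sums_of_newton d (A S : nat -> C) :
  A 0%N = 1 -> (forall k, (d < k)%N -> A k = 0) ->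
  (forall n, n%:R * A n = \sum_(1 <= j < n.+1) S j * A (n - j)%N) ->
  exists2 w : seq C, (size w <= d)%N &
    forall n, (0 < n)%N -> S n = - \sum_(z <- w) z ^+ n.
Proof.
move=> A0 Ad newton; pose L := \poly_(k < d.+1) A k.
have LE k : L`_k = A k by rewrite coef_poly ltnS; case: leqP => // /Ad.
have L0 : L != 0.
  by apply/eqP => /(congr1 (fun q : {poly C} => q`_0)); rewrite LE A0 coef0; apply/eqP/oner_neq0.
have [r rE] := closed_field_poly_normal L.
have lc0 : lead_coef L != 0 by rewrite lead_coef_eq0.
have L00 : L.[0] = 1 by rewrite horner_coef0 LE A0.
have r0 z : z \in r -> z != 0.
  move=> zr; apply/eqP => z0; have : root L 0.
    by rewrite rE rootZ // root_prod_XsubC -z0.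
  by rewrite rootE L00 oner_eq0.
have LwE : L = \prod_(z <- [seq z^-1 | z <- r]) (1 - z *: 'X).
  have E : \prod_(z <- r) ('X - z%:P) =
      (\prod_(z <- r) - z) *: \prod_(z <- [seq z^-1 | z <- r]) (1 - z *: 'X).
    rewrite big_map -mul_polyC rmorph_prod -big_split /=.
    apply: eq_big_seq => z /r0 z0.
    by rewrite mulrBr mulr1 mul_polyC scalerA mulNr mulfV // scaleN1r opprK addrC polyCN.
  move: (lead_coef L) rE => c rE; rewrite E scalerA in rE.
  have := L00; rewrite rE hornerZ horner_prod.
  have -> : \prod_(z <- [seq z^-1 | z <- r]) (1 - z *: 'X).[0] = 1.
    by apply: big1 => z _; rewrite !hornerE ?mulr0 ?subr0.
  by rewrite mulr1 => ->; rewrite scale1r.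
exists [seq z^-1 | z <- r].
  have := size_poly d.+1 A; rewrite -/L rE size_scale //.
  by rewrite (size_prod_XsubC _ id) size_map.
elim/ltn_ind => n IH n0; have := newton n; rewrite -LE {1}LwE newton_prod -LwE.
rewrite !big_add1 /= !big_mkord; case: n n0 IH => // n _ IH.
rewrite !big_ord_recr /= subnn LE A0 !mulr1 opprD.
rewrite -sumrN => E; apply: (addrI (\sum_(i < n) S i.+1 * A (n.+1 - i.+1)%N)).
rewrite -E; congr (_ + _); apply: eq_bigr => j _.
by rewrite LE IH ?mulNr // ltnS.
Qed.
End NewtonIdentities.

(** * Characters *)

Section SecondCoefficient.
Variable F : fieldType.

(* The coefficient of degree [n - 1] of a polynomial of degree [n], which is [0] for [n = 0]. *)
Definition second_coef (g : {poly F}) : F := ('X * g)`_(size g).-1.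

Lemma second_coefM g h : g \is monic -> h \is monic ->
  second_coef (g * h) = second_coef g + second_coef h.
Proof.
move=> mg mh; have g0 := monic_neq0 mg; have h0 := monic_neq0 mh.
have [m sg] : exists m, size g = m.+1.
  by exists (size g).-1; rewrite prednK // size_poly_gt0.
have [n sh] : exists n, size h = n.+1.
  by exists (size h).-1; rewrite prednK // size_poly_gt0.
have su := size_monic_subXn mg sg; have sv := size_monic_subXn mh sh.
rewrite /second_coef size_Mmonic // sg sh addSn addnS /=.
set u := g - 'X^m in su; set v := h - 'X^n in sv.
have uE : g = 'X^m + u by rewrite addrC subrK.
have vE : h = 'X^n + v by rewrite addrC subrK.
clearbody u v.
have -> : 'X * (g * h) = 'X^((m + n).+1) + 'X^n * ('X * u) + 'X^m * ('X * v) + 'X * (u * v).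
  by rewrite uE vE exprS exprD; ring.
rewrite uE vE !mulrDr -!exprS !coefD !coefXn !(ltn_eqF (ltnSn _)) !add0r.
rewrite !coefXnM ltnNge leq_addl /= addnK ltnNge leq_addr /= addKn.
rewrite [X in _ + X](_ : _ = 0) ?addr0 // coefXM; case: eqP => // mn.
rewrite nth_default //; apply: leq_trans (size_polyMleq _ _) _.
by move: su sv; move: (size u) (size v) => a b; lia.
Qed.

Lemma second_coef_prod_XsubC n (y : 'I_n -> F) :
  second_coef (\prod_(i < n) ('X - (y i)%:P)) = - \sum_(i < n) y i.
Proof.
elim: n y => [|n IH] y; first by rewrite !big_ord0 oppr0 /second_coef size_poly1 mulr1 coefX.
rewrite !big_ord_recr /= second_coefM ?monicXsubC ?monic_prod // => [|i _]; last exact: monicXsubC.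
rewrite IH opprD; congr (_ + _).
by rewrite /second_coef size_XsubC /= coefXM /= coefB coefX coefC eqxx /= sub0r.
Qed.
End SecondCoefficient.

Lemma second_coef_map (F L : fieldType) (f : {rmorphism F -> L}) g :
  second_coef (map_poly f g) = f (second_coef g).
Proof.
by rewrite /second_coef size_map_poly -[X in X * _](map_polyX f) -rmorphM coef_map.
Qed.

Definition mult_char (F : fieldType) (chi : F -> algC) :=
  [/\ chi 0 = 0, chi 1 = 1 & {morph chi : x y / x * y}].

Definition add_char (F : fieldType) (psi : F -> algC) :=
  psi 0 = 1 /\ {morph psi : x y / x + y >-> x * y}.

Section Characters.
Variables (p : nat) (p_pr : prime p).
Variables (chi : 'F_p -> algC) (psi : 'F_p -> algC).
Hypotheses (chiP : mult_char chi) (psiP : add_char psi).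
Hypotheses (chi1 : exists2 t, t != 0 & chi t != 1) (psi1 : exists t, psi t != 1).

Lemma add_char_norm x : `|psi x| = 1.
Proof.
have [psi0 psiD] := psiP.
have psiMn n : psi (x *+ n) = psi x ^+ n.
  by elim: n => [|n IH]; rewrite ?mulr0n ?psi0 ?expr0 // mulrS psiD IH exprS.
have : psi x ^+ p = 1.
  by rewrite -psiMn -mulr_natr pchar_Fp_0 // mulr0 psi0.
move/(congr1 (fun y => `|y|)); rewrite normrX normr1 => /eqP.
by rewrite pexpr_eq1 ?prime_gt0 // => /eqP.
Qed.

Lemma mult_char_norm x : x != 0 -> `|chi x| = 1.
Proof.
have [chi0 chi_1 chiM] := chiP; move=> x0.
have chiX n : chi (x ^+ n) = chi x ^+ n.
  by elim: n => [|n IH]; rewrite ?expr0 ?chi_1 // exprS chiM IH exprS.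
have p1 : (0 < p.-1)%N by have := prime_gt1 p_pr; lia.
have : chi x ^+ p.-1 = 1.
  have : x ^+ p.-1.+1 = x.
    by rewrite prednK ?prime_gt0 //; have := expf_card x; rewrite card_Fp.
  by rewrite -chiX exprSr -[RHS]mul1r => /(mulIf x0) ->.
move/(congr1 (fun y => `|y|)); rewrite normrX normr1 => /eqP.
by rewrite pexpr_eq1 // => /eqP.
Qed.

Lemma mult_char_norm_le1 x : `|chi x| <= 1.
Proof.
have [->|x0] := eqVneq x 0; last by rewrite mult_char_norm.
by have [-> _ _] := chiP; rewrite normr0 ler01.
Qed.

Lemma mult_char_conj x : chi x * (chi x)^* = (x != 0)%:R.
Proof.
rewrite -normCK; have [->|x0] := eqVneq x 0; last by rewrite mult_char_norm ?expr1n.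
by have [-> _ _] := chiP; rewrite normr0 expr0n.
Qed.

Lemma add_char_conj x : (psi x)^* = psi (- x).
Proof.
have [psi0 psiD] := psiP; have := add_char_norm x.
have px0 : psi x != 0 by rewrite -normr_eq0 add_char_norm oner_eq0.
move=> nx; apply: (mulfI px0); rewrite -normCK nx expr1n -psiD subrr psi0 //.
Qed.

Lemma mult_char_sum0 : \sum_(t | t != 0) chi t = 0.
Proof.
have [chi0 chi_1 chiM] := chiP; have [t t0 tn1] := chi1.
have E : \sum_(x | x != 0) chi x = chi t * \sum_(x | x != 0) chi x.
  rewrite {1}(reindex_inj (mulfI t0)) /= mulr_sumr; apply: eq_big => x.
    by rewrite mulf_eq0 (negPf t0).
  by rewrite chiM.
apply/eqP; move/eqP: E; rewrite -{1}[\sum_(_ | _) _]mul1r -subr_eq0 -mulrBl mulf_eq0.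
by rewrite subr_eq0 eq_sym (negPf tn1).
Qed.

Lemma add_char_sum u : \sum_(c : 'F_p) psi (c * u) = (if u == 0 then p%:R else 0).
Proof.
have [psi0 psiD] := psiP; case: eqP => [->|/eqP u0].
  under eq_bigr => c _ do rewrite mulr0 psi0.
  by rewrite sumr_const card_Fp.
have [t tn1] := psi1.
rewrite (reindex_inj (mulIf (invr_neq0 u0))) /=.
under eq_bigr => c _ do rewrite divfK //.
have E : \sum_c psi c = psi t * \sum_c psi c.
  rewrite {1}(reindex_inj (addrI t)) /= mulr_sumr; apply: eq_bigr => c _.
  by rewrite psiD.
apply/eqP; move/eqP: E; rewrite -{1}[\sum_c _]mul1r -subr_eq0 -mulrBl mulf_eq0.
by rewrite subr_eq0 eq_sym (negPf tn1).
Qed.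

(** On the characteristic polynomial of x this becomes [chi] of the norm of the product of the a -
    x, times [psi] of -c times the trace of x; see [dirichlet_orbit]. *)
Definition dirichlet (s : seq 'F_p) (c : 'F_p) (g : {poly 'F_p}) : algC :=
  chi (\prod_(a <- s) g.[a]) * psi (c * second_coef g).

Lemma dirichletM s c g h : g \is monic -> h \is monic ->
  dirichlet s c (g * h) = dirichlet s c g * dirichlet s c h.
Proof.
have [_ _ chiM] := chiP; have [_ psiD] := psiP; move=> mg mh.
rewrite /dirichlet second_coefM // mulrDr psiD.
under eq_bigr => a _ do rewrite hornerM.
by rewrite big_split /= chiM mulrACA.
Qed.

Lemma monic_sum_dirichlet0 s c : monic_sum (dirichlet s c) 0 = 1.
Proof.
have [chi0 chi_1 chiM] := chiP; have [psi0 _] := psiP.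
rewrite /monic_sum (big_pred1 0); last by move=> v; apply/esym/eqP; apply: thinmx0.
rewrite /monic_of linear0 addr0 expr0 /dirichlet big1 => [|a _]; last by rewrite hornerE.
by rewrite chi_1 mul1r /second_coef size_poly1 mulr1 coefX mulr0 psi0.
Qed.

(* Multiplying [g.[a]] by [t] while keeping the other data of [g] permutes the
   monic polynomials of degree [n] and multiplies the character by [chi t]. *)
Lemma monic_sum_dirichlet_eq0 s c n : uniq s -> (0 < size s < n)%N ->
  monic_sum (dirichlet s c) n = 0.
Proof.
case: s => // a s /= /andP[as_ us] sn; have [t t0 tn1] := chi1.
have [chi0 chi_1 chiM] := chiP.
(* [h] is the Lagrange polynomial with value 1 at [a] and 0 at the other points. Its degree is at
   most n - 2, so adding a multiple of it leaves the second coefficient unchanged. *)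
pose h0 := \prod_(b <- s) ('X - b%:P); pose h := (h0.[a])^-1 *: h0.
have h0a : h0.[a] != 0 by rewrite -rootE root_prod_XsubC.
have sh : (size h <= (size s).+1)%N.
  by apply: leq_trans (size_scale_leq _ _) _; rewrite (size_prod_XsubC _ id).
pose f (v : 'rV['F_p]_n) := v + poly_rV (((t - 1) * (monic_of v).[a]) *: h).
have fE v : monic_of (f v) = monic_of v + ((t - 1) * (monic_of v).[a]) *: h.
  rewrite /monic_of linearD /= addrA poly_rV_K //.
  by apply: leq_trans (size_scale_leq _ _) (leq_trans sh (ltnW sn)).
have fa v : (monic_of (f v)).[a] = t * (monic_of v).[a].
  rewrite fE hornerD !hornerZ mulVf // mulr1; ring.
have fI : injective f.
  move=> v w E; have E2 : (monic_of v).[a] = (monic_of w).[a].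
    by apply: (mulfI t0); rewrite -!fa E.
  by move: E; rewrite /f E2 => /addIr.
have LE v : dirichlet (a :: s) c (monic_of (f v)) = chi t * dirichlet (a :: s) c (monic_of v).
  rewrite /dirichlet !big_cons fa !chiM !mulrA; congr (_ * _ * _); last first.
    congr (psi (c * _)); rewrite /second_coef !size_monic_of /= fE mulrDr coefD.
    rewrite [X in _ + X]nth_default ?addr0 // -scalerAr.
    apply: leq_trans (size_scale_leq _ _) _; apply: leq_trans (size_polyMleq _ _) _.
    by rewrite size_polyX; apply: leq_trans sn; rewrite ltnS.
  congr (chi _); apply: eq_big_seq => b bs; rewrite fE hornerD !hornerZ.
  have -> : h0.[b] = 0 by apply/eqP; rewrite -rootE root_prod_XsubC.
  by rewrite !mulr0 addr0.
have E : monic_sum (dirichlet (a :: s) c) n = chi t * monic_sum (dirichlet (a :: s) c) n.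
  by rewrite {1}/monic_sum (reindex_inj fI) /= mulr_sumr; apply: eq_bigr => v _.
apply/eqP; move/eqP: E; rewrite -{1}[monic_sum _ _]mul1r -subr_eq0 -mulrBl mulf_eq0.
by rewrite subr_eq0 eq_sym (negPf tn1).
Qed.
End Characters.

(** * Weil's bound *)

Lemma power_bounded_le1 (x B : algC) : 0 <= x -> (forall m, x ^+ m <= B) -> x <= 1.
Proof.
move=> x0 xB; have B0 : 0 <= B by apply: le_trans (xB 0%N); rewrite expr0 ler01.
have [//|x1] := real_leP (ger0_real x0) (real1 _).
have d0 : 0 < x - 1 by rewrite subr_gt0.
have ber m : 1 + m%:R * (x - 1) <= x ^+ m.
  elim: m => [|m IH]; first by rewrite mul0r addr0 expr0.
  rewrite exprS; apply: le_trans (ler_wpM2l x0 IH).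
  have -> : x * (1 + m%:R * (x - 1)) = 1 + m.+1%:R * (x - 1) + m%:R * (x - 1) ^+ 2.
    by rewrite -[m.+1]addn1 natrD; ring.
  by rewrite lerDl mulr_ge0 ?ler0n // exprn_ge0 // ltW.
have := archi_boundP (divr_ge0 B0 (ltW d0)); set m := Num.bound _ => Bm.
have := le_trans (ber m) (xB m); move: Bm; rewrite ltr_pdivrMr // => Bm.
move=> le_B; have : m%:R * (x - 1) < B.
  by apply: lt_le_trans le_B; rewrite ltrDr ltr01.
by move/(lt_trans Bm); rewrite ltxx.
Qed.

(** A polynomial [q] vanishing at all entries other than b isolates b: combining consecutive power
    sums with the coefficients of [q] leaves the multiplicity of b times b^m q(b). Hence the powers
    of |b|/r stay bounded, whatever [B] is. *)
Lemma power_sums_bound (s : seq algC) (B r : algC) :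
  0 < r -> (forall m, (0 < m)%N -> `|\sum_(z <- s) z ^+ m| <= B * r ^+ m) ->
  forall b, b \in s -> `|b| <= r.
Proof.
move=> r0 sB b bs; pose q := \prod_(z <- undup s | z != b) ('X - z%:P).
have q0 : q.[b] != 0.
  rewrite horner_prod prodf_seq_neq0; apply/allP => z _; apply/implyP => zb.
  by rewrite !hornerE subr_eq0 eq_sym.
have qs z : z \in s -> z != b -> q.[z] = 0.
  move=> zs zb; rewrite horner_prod (big_rem z) /= ?mem_undup // zb.
  by rewrite !hornerE subrr mul0r.
have key m : \sum_(k < size q) q`_k * (\sum_(z <- s) z ^+ (m + k)) =
    (count_mem b s)%:R * (b ^+ m * q.[b]).
  transitivity (\sum_(z <- s) z ^+ m * q.[z]).
    under eq_bigr => k _ do rewrite mulr_sumr.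
    rewrite exchange_big /=; apply: eq_bigr => z _.
    rewrite horner_coef mulr_sumr; apply: eq_bigr => k _.
    by rewrite exprD; ring.
  rewrite (bigID (pred1 b)) /= [X in _ + X]big1_seq ?addr0; last first.
    by move=> z /andP[zb zs]; rewrite qs // mulr0.
  rewrite (eq_bigr (fun=> b ^+ m * q.[b])); last by move=> z /eqP ->.
  by rewrite big_const_seq iter_addr_0 mulr_natl.
pose D := B * \sum_(k < size q) `|q`_k| * r ^+ k.
have bnd m : (0 < m)%N -> `|b| ^+ m * `|q.[b]| <= D * r ^+ m.
  move=> m0; apply: (@le_trans _ _ `|(count_mem b s)%:R * (b ^+ m * q.[b])|).
    rewrite !normrM normr_nat normrX ler_peMl ?mulr_ge0 ?exprn_ge0 //.
    by rewrite ler1n -has_count has_pred1.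
  rewrite -key; apply: le_trans (ler_norm_sum _ _ _) _.
  rewrite /D mulr_sumr mulr_suml; apply: ler_sum => k _.
  rewrite normrM (le_trans (ler_wpM2l _ (sB _ _))) // ?addn_gt0 ?m0 //.
  by rewrite exprD le_eqVlt; apply/orP; left; apply/eqP; ring.
have nq0 : 0 < `|q.[b]| by rewrite normr_gt0.
have D0 : 0 <= D.
  have := bnd 1%N isT; rewrite expr1 => /(le_trans (mulr_ge0 (normr_ge0 b) (ltW nq0))).
  by rewrite pmulr_lge0.
suff : `|b| / r <= 1 by rewrite ler_pdivrMr // mul1r.
apply: (@power_bounded_le1 _ (1 + D / `|q.[b]|)).
  by rewrite divr_ge0 // ltW.
case=> [|m]; first by rewrite expr0 lerDl divr_ge0 // ltW.
rewrite expr_div_n ler_pdivrMr ?exprn_gt0 //.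
apply: (@le_trans _ _ (D / `|q.[b]| * r ^+ m.+1)).
  by rewrite mulrAC ler_pdivlMr ?bnd.
by rewrite ler_wpM2r ?exprn_ge0 ?ltW // ltrDr ltr01.
Qed.

(** The exponent (p^n - 1)/(p - 1), which realizes the norm from the field with p^n elements to
    ['F_p]. *)
Definition geom (p n : nat) := (\sum_(i < n) p ^ i)%N.

Lemma geom_spec p n : (0 < p)%N -> (p ^ n = p.-1 * geom p n + 1)%N.
Proof. by move=> p0; rewrite /geom -predn_exp addn1 prednK // expn_gt0 p0. Qed.

(** Writes the norm exponent in even degree 2n in the form q(M + 1) required by [stepanov_bound],
    with M = p^n. *)
Lemma geom_double p n : (geom p n.*2 = geom p n * (p ^ n).+1)%N.
Proof.
rewrite /geom -addnn big_split_ord /= mulnSr addnC -[in LHS]/(_ + _)%N; congr (_ + _)%N.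
by rewrite mulnC big_distrr /=; apply: eq_bigr => i _; rewrite expnD.
Qed.

(** * Norms, traces and Artin-Schreier fibres *)

Section ClosureSums.
Variables (p : nat) (p_pr : prime p) (K : closedFieldType).
Variable (emb : {rmorphism 'F_p -> K}).
Variables (chi : 'F_p -> algC) (psi : 'F_p -> algC).
Hypotheses (chiP : mult_char chi) (psiP : add_char psi).
Hypotheses (chi1 : exists2 t, t != 0 & chi t != 1) (psi1 : exists t, psi t != 1).
Variable (s : seq 'F_p).

Let pK : p \in [pchar K] := pchar_closure p_pr emb.

Definition trace n (x : K) : K := \sum_(i < n) x ^+ (p ^ i).
Definition closure_norm n (x : K) : 'F_p :=
  descent emb ((\prod_(a <- s) (emb a - x)) ^+ geom p n).

Lemma trace_fixed n x : x ^+ (p ^ n) = x -> trace n x ^+ p = trace n x.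
Proof.
move=> xn; rewrite -(pFrobenius_autE pK) /trace rmorph_sum /=.
case: n xn => [|n] xn; first by rewrite !big_ord0.
rewrite big_ord_recr big_ord_recl /= pFrobenius_autE -exprM -expnSr xn expn0 expr1 addrC.
by congr (_ + _); apply: eq_bigr => i _; rewrite pFrobenius_autE -exprM -expnSr.
Qed.

Lemma norm_conj n x a : \prod_(i < n) (emb a - x ^+ (p ^ i)) = (emb a - x) ^+ geom p n.
Proof.
rewrite /geom expr_sum; apply: eq_bigr => i _.
rewrite frobeniusB //; congr (_ - _); elim: (nat_of_ord i) => [|k IH].
  by rewrite expn0 expr1.
rewrite expnSr exprM -IH -rmorphXn; congr (emb _).
by have := expf_card a; rewrite card_Fp.
Qed.

Lemma closure_norm_spec n x : x ^+ (p ^ n) = x ->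
  let o := map_poly (descent emb) (orbit_poly p n x) in
  emb (\prod_(a <- s) o.[a]) = (\prod_(a <- s) (emb a - x)) ^+ geom p n.
Proof.
move=> xn o; rewrite rmorph_prod -prodrXl; apply: eq_bigr => a _.
rewrite -horner_map /= orbit_poly_descent // /orbit_poly horner_prod -norm_conj.
by apply: eq_bigr => i _; rewrite !hornerE.
Qed.

Lemma dirichlet_orbit n x c : x ^+ (p ^ n) = x ->
  dirichlet chi psi s c (map_poly (descent emb) (orbit_poly p n x)) =
  chi (closure_norm n x) * psi (c * - descent emb (trace n x)).
Proof.
move=> xn; rewrite /dirichlet; congr (chi _ * psi (_ * _)).
  by rewrite /closure_norm -closure_norm_spec // embK.
apply: (fmorph_inj emb); rewrite rmorphN descentK ?trace_fixed //.
by rewrite -second_coef_map orbit_poly_descent // second_coef_prod_XsubC.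
Qed.

Lemma trace_artin_schreier n z : trace n (z ^+ p - z) = z ^+ (p ^ n) - z.
Proof.
rewrite /trace; elim: n => [|n IH]; first by rewrite big_ord0 expn0 expr1 subrr.
by rewrite big_ord_recr /= IH frobeniusB // -exprM -expnS; ring.
Qed.

Lemma artin_schreier_roots (x : K) : exists r : seq K,
  [/\ uniq r, size r = p & forall z, (z \in r) = (z ^+ p - z == x)].
Proof.
have [r rE] := closed_field_poly_normal ('X^p - ('X + x%:P)).
have sq : (size ('X + x%:P : {poly K})%R < size ('X^p : {poly K})%R)%N.
  by rewrite size_polyXn size_XaddC ltnS prime_gt1.
rewrite lead_coefDl ?size_polyN // lead_coefXn scale1r in rE.
exists r; split.
- rewrite -separable_prod_XsubC -rE unlock derivB derivD derivXn derivX derivC addr0.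
  have := pK => /andP[_ /eqP pK0].
  rewrite -mulr_natr -polyC_natr pK0 mulr0 sub0r.
  rewrite (_ : - 1 = (- 1) *: 1); last by rewrite scaleN1r.
  by rewrite coprimepZr ?coprimep1 // oppr_eq0 oner_eq0.
- apply: succn_inj; rewrite -(size_prod_XsubC _ id) -rE size_polyDl ?size_polyN //.
  by rewrite size_polyXn.
- by move=> z; rewrite -root_prod_XsubC -rE rootE !hornerE opprD addrA subr_eq0.
Qed.

(** Additive Hilbert 90 by telescoping: every z with z^p - z = x satisfies z^(p^n) - z = trace of x,
    so either all p solutions lie in the field with p^n elements or none does. *)
Lemma artin_schreier_count n x : (0 < n)%N -> x ^+ (p ^ n) = x ->
  count (fun z => z ^+ p - z == x) (fixed_points p K n) =
  (if trace n x == 0 then p else 0%N).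
Proof.
move=> n0 xn; have [r [ur sr rP]] := artin_schreier_roots x.
case: eqP => tx; last first.
  apply/eqP; rewrite -leqn0 leqNgt -has_count; apply/hasPn => z.
  rewrite mem_fixed_points // => /eqP zn; apply/eqP => zx; apply: tx.
  by rewrite -zx trace_artin_schreier zn subrr.
rewrite -[RHS]sr -size_filter; apply/perm_size/uniq_perm => //.
  by rewrite filter_uniq ?uniq_fixed_points.
move=> z; rewrite mem_filter mem_fixed_points // rP; case: eqP => //= zx.
by rewrite -subr_eq0 -trace_artin_schreier zx tx eqxx.
Qed.

(** Orthogonality in c keeps the x of trace 0 with weight p, and p is the number of z with z^p - z =
    x. *)
Lemma closure_sum_total n : (0 < n)%N ->
  \sum_(c : 'F_p) closure_sum emb (dirichlet chi psi s c) n =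
  \sum_(z <- fixed_points p K n) chi (closure_norm n (z ^+ p - z)).
Proof.
move=> n0; rewrite /closure_sum exchange_big /=.
transitivity (\sum_(x <- fixed_points p K n) chi (closure_norm n x) *
    (count (fun z => z ^+ p - z == x) (fixed_points p K n))%:R).
  apply: eq_big_seq => x; rewrite mem_fixed_points // => /eqP xn.
  under eq_bigr => c _ do rewrite dirichlet_orbit //.
  rewrite -mulr_sumr add_char_sum // artin_schreier_count // oppr_eq0.
  have -> : (descent emb (trace n x) == 0) = (trace n x == 0).
    by rewrite -(fmorph_eq0 emb) descentK // trace_fixed.
  by case: ifP.
have countE x : (count (fun z : K => z ^+ p - z == x) (fixed_points p K n))%:R =
    \sum_(z <- fixed_points p K n) (z ^+ p - z == x)%:R :> algC.
  by elim: (fixed_points p K n) => [|z r IH] /=; rewrite ?big_nil // big_cons natrD IH.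
under [LHS]eq_bigr => x _ do rewrite countE mulr_sumr.
rewrite exchange_big /=; apply: eq_big_seq => z; rewrite mem_fixed_points // => /eqP zn.
rewrite (bigD1_seq (z ^+ p - z)) ?uniq_fixed_points //= ?eqxx ?mulr1.
  by rewrite big1 ?addr0 // => x xz; rewrite eq_sym (negPf xz) mulr0.
by rewrite mem_fixed_points // frobeniusB // -!exprM mulnC exprM zn.
Qed.
End ClosureSums.

Section ClosureBound.
Variables (p : nat) (p_pr : prime p) (p_gt2 : (2 < p)%N) (K : closedFieldType).
Variable (emb : {rmorphism 'F_p -> K}).
Variable (chi : 'F_p -> algC).
Hypotheses (chiP : mult_char chi) (chi1 : exists2 t, t != 0 & chi t != 1).
Variable (s : seq 'F_p).
Hypothesis us : uniq (0 :: s).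

(** Up to signs, f(z^p - z). The shift 0 contributes the factor X(1 - X^(p-1)) and the other shifts
    are nonzero, so g has a simple zero at 0, as Stepanov's argument demands. *)
Let g : {poly K} := \prod_(a <- 0 :: s) ((emb a)%:P - ('X^p - 'X)).
Let e := ((size s).+1 * p)%N.

Lemma artin_schreier_poly_spec : exists2 g0, g = 'X * g0 & g0.[0] != 0.
Proof.
exists ((1 - 'X^(p.-1)) * \prod_(a <- s) ((emb a)%:P - ('X^p - 'X))).
  rewrite /g big_cons rmorph0 polyC0 sub0r opprB mulrA; congr (_ * _).
  by rewrite mulrBr mulr1 -exprS prednK ?prime_gt0.
have p0 : (p == 0)%N = false by apply/negbTE; rewrite -lt0n prime_gt0.
have p10 : (p.-1 == 0)%N = false by apply/negbTE; rewrite -lt0n -ltnS prednK ?prime_gt1 ?prime_gt0.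
rewrite hornerM !hornerE ?hornerXn expr0n p10 subr0 mul1r horner_prod.
rewrite prodf_seq_neq0; apply/allP => a as_ /=.
rewrite !hornerE ?hornerXn expr0n p0 !subr0 fmorph_eq0.
by apply: contraTneq as_ => ->; have := us => /= /andP[].
Qed.

Lemma size_artin_schreier_poly : (size g <= e.+1)%N.
Proof.
rewrite /g /e -[(size s).+1]/(size (@cons 'F_p 0 s)); elim: (0 :: s) => [|a r IH]; first by rewrite big_nil size_poly1.
rewrite big_cons; apply: leq_trans (size_polyMleq _ _) _.
have h : (size ((emb a)%:P - ('X^p - 'X) : {poly K})%R <= p.+1)%N.
  apply: leq_trans (size_polyD _ _) _; rewrite geq_max size_polyN.
  rewrite (leq_trans (size_polyC_leq1 _)) //= (leq_trans (size_polyD _ _)) //.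
  by rewrite geq_max size_polyN size_polyXn size_polyX leqnn /= ltnS prime_gt0.
by move: h IH; rewrite /= mulSn; move: (size _) (size _) => x y; lia.
Qed.

Lemma closure_norm_emb n x : x ^+ (p ^ n) = x ->
  emb (closure_norm emb (0 :: s) n x) =
  (\prod_(a <- 0 :: s) (emb a - x)) ^+ geom p n.
Proof. by move=> xn; rewrite /closure_norm -closure_norm_spec // embK. Qed.

Lemma fixed_artin_schreier n (z : K) : z ^+ (p ^ n) = z ->
  (z ^+ p - z) ^+ (p ^ n) = z ^+ p - z.
Proof. by move=> zn; rewrite frobeniusB ?(pchar_closure p_pr emb) // -!exprM mulnC exprM zn. Qed.

Lemma horner_artin_schreier_poly (z : K) :
  g.[z] = \prod_(a <- 0 :: s) (emb a - (z ^+ p - z)).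
Proof.
by rewrite /g horner_prod; apply: eq_bigr => a _; rewrite !hornerE ?hornerXn.
Qed.

Let fibre n (zeta : 'F_p) : seq K :=
  [seq z <- fixed_points p K n | closure_norm emb (0 :: s) n (z ^+ p - z) == zeta].

Lemma fibre_bound m zeta : (0 < m)%N -> zeta != 0 ->
  (size (fibre m.*2 zeta) <= (geom p m + 3 * e + 4) * p ^ m)%N.
Proof.
move=> m0 z0; have [g0 gE g00] := artin_schreier_poly_spec.
have m20 : (0 < m.*2)%N by rewrite double_gt0.
apply: (stepanov_bound (pchar_closure p_pr emb) gE g00 size_artin_schreier_poly
  (s := p.-1) (zeta := emb zeta)).
- exact/geom_spec/prime_gt0.
- by apply: leq_trans p_gt2 _; rewrite -{1}(expn1 p) leq_exp2l ?prime_gt1.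
- by rewrite -ltnS prednK ?prime_gt1 ?prime_gt0.
- by rewrite fmorph_eq0.
- by rewrite filter_uniq ?uniq_fixed_points.
- move=> z; rewrite mem_filter mem_fixed_points // => /andP[/eqP <- /eqP zn]; split.
    by rewrite -expnM muln2.
  by rewrite closure_norm_emb ?fixed_artin_schreier // -geom_double horner_artin_schreier_poly.
Qed.

Lemma fibre0_bound n : (0 < n)%N -> (size (fibre n 0%R) <= e)%N.
Proof.
move=> n0; have [g0 gE g00] := artin_schreier_poly_spec.
have gN : g != 0.
  rewrite gE mulf_neq0 ?polyX_eq0 //; apply: contraNneq g00 => ->.
  by rewrite horner0.
rewrite -ltnS; apply: leq_trans size_artin_schreier_poly.
apply: max_poly_roots => //; last by rewrite filter_uniq ?uniq_fixed_points.
apply/allP => z; rewrite mem_filter mem_fixed_points // => /andP[/eqP nz /eqP zn].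
have := closure_norm_emb (fixed_artin_schreier zn); rewrite nz rmorph0 => /esym/eqP.
by rewrite expf_eq0 -horner_artin_schreier_poly => /andP[].
Qed.

(** Since [chi] sums to 0 over nonzero arguments, fibre sizes may be replaced by their deficits from
    the common upper bound [U]. Deficits are nonnegative and, as the fibres total p^n = (p^m)^2,
    their sum is only a constant times p^m. *)
Lemma closure_sum_bound m : (0 < m)%N ->
  `|\sum_(z <- fixed_points p K m.*2) chi (closure_norm emb (0 :: s) m.*2 (z ^+ p - z))|
  <= (p.-1 * (3 * e + 4) + e)%:R * p%:R ^+ m.
Proof.
move=> m0; set n := m.*2; have n0 : (0 < n)%N by rewrite double_gt0.
pose U := ((geom p m + 3 * e + 4) * p ^ m)%N.
have sumE (F : 'F_p -> algC) :
    \sum_(z <- fixed_points p K n) F (closure_norm emb (0 :: s) n (z ^+ p - z)) =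
    \sum_zeta F zeta * (size (fibre n zeta))%:R.
  have sE zeta : (size (fibre n zeta))%:R = \sum_(z <- fixed_points p K n)
      (closure_norm emb (0 :: s) n (z ^+ p - z) == zeta)%:R :> algC.
    rewrite size_filter; elim: (fixed_points p K n) => [|z r IH] /=; rewrite ?big_nil //.
    by rewrite big_cons natrD IH.
  under [RHS]eq_bigr => zeta _ do rewrite sE mulr_sumr.
  rewrite exchange_big /=; apply: eq_bigr => z _.
  rewrite (bigD1 (closure_norm emb (0 :: s) n (z ^+ p - z))) //= eqxx mulr1 big1 ?addr0 //.
  by move=> zeta zz; rewrite eq_sym (negPf zz) mulr0.
have cardE : (\sum_(zeta : 'F_p) size (fibre n zeta) = p ^ n)%N.
  have := sumE (fun=> 1); rewrite big_const_seq count_predT iter_addr_0 size_fixed_points //.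
  under [RHS]eq_bigr => zeta _ do rewrite mul1r.
  by rewrite -natr_sum => /eqP; rewrite eqr_nat => /eqP.
have [chi0 _ _] := chiP.
rewrite sumE (bigD1 0) //= chi0 mul0r add0r.
have -> : \sum_(zeta | zeta != 0) chi zeta * (size (fibre n zeta))%:R =
    - \sum_(zeta | zeta != 0) chi zeta * (U - size (fibre n zeta))%:R.
  apply/eqP; rewrite -addr_eq0 -big_split /=.
  rewrite (eq_bigr (fun zeta => chi zeta * U%:R)).
    by rewrite -mulr_suml mult_char_sum0 // mul0r.
  by move=> zeta z0; rewrite -mulrDr -natrD subnKC // fibre_bound.
rewrite normrN; apply: (@le_trans _ _
  (\sum_(zeta : 'F_p | zeta != 0) (U - size (fibre n zeta))%:R)).
  apply: le_trans (ler_norm_sum _ _ _) _; apply: ler_sum => zeta z0.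
  by rewrite normrM normr_nat mult_char_norm // mul1r.
rewrite -natr_sum -natrX -natrM ler_nat.
have := cardE; rewrite (bigD1 0) //= => cE.
have sumU : (\sum_(zeta : 'F_p | zeta != 0%R) (U - size (fibre n zeta)) +
    \sum_(zeta : 'F_p | zeta != 0%R) size (fibre n zeta) = p.-1 * U)%N.
  rewrite -big_split /= (eq_bigr (fun=> U)); last first.
    by move=> zeta z0; rewrite subnK // fibre_bound.
  rewrite sum_nat_const; congr (_ * _)%N.
  by rewrite cardC1 card_Fp.
have f0 := fibre0_bound n0.
have QE : (p ^ n = p ^ m * p ^ m)%N by rewrite /n -addnn expnD.
have gE := geom_spec m (prime_gt0 p_pr).
have UE : (p.-1 * U = (p ^ m - 1) * p ^ m + p.-1 * (3 * e + 4) * p ^ m)%N.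
  by rewrite {1}gE addnK /U; ring.
have pm0 : (0 < p ^ m)%N by rewrite expn_gt0 prime_gt0.
have e1 : (e <= e * p ^ m)%N by rewrite leq_pmulr.
rewrite mulnDl; move: sumU cE; rewrite UE QE mulnBl mul1n.
move: f0 e1 pm0; move: (size _) (\sum_(_ | _) _)%N (\sum_(_ | _) _)%N.
move: (p.-1 * _ * _)%N (e * _)%N => a b x y z.
have : (p ^ m <= p ^ m * p ^ m)%N by rewrite leq_pmulr // expn_gt0 prime_gt0.
move: (p ^ m * p ^ m)%N (p ^ m)%N => M2 M; lia.
Qed.
End ClosureBound.

Section Weil.
Variables (p : nat) (p_pr : prime p) (p_gt2 : (2 < p)%N).
Variables (chi : 'F_p -> algC) (psi : 'F_p -> algC).
Hypotheses (chiP : mult_char chi) (psiP : add_char psi).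
Hypotheses (chi1 : exists2 t, t != 0 & chi t != 1) (psi1 : exists t, psi t != 1).

Lemma weil_bound0 (s : seq 'F_p) (c : 'F_p) : uniq (0 :: s) ->
  `|\sum_(x : 'F_p) chi (\prod_(a <- 0 :: s) (x + a)) * psi (c * x)|
  <= (size s).+1%:R * sqrtC p%:R.
Proof.
move=> us; have [K [emb _]] := countable_algebraic_closure 'F_p.
pose S c := closure_sum emb (dirichlet chi psi (0 :: s) c).
have := fin_all_exists2 (fun c : 'F_p => power_sums_of_newton
  (monic_sum_dirichlet0 chiP psiP (0 :: s) c)
  (fun k dk => monic_sum_dirichlet_eq0 psi chiP chi1 c us dk)
  (newton_euler p_pr emb (dirichletM chiP psiP (0 :: s) c))).
case=> w sw wE.
(* Squares, because the estimate is available in even degrees 2m only; all frequencies are pooled,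
   because only their sum over c is estimated. *)
pose W := flatten [seq [seq z ^+ 2 | z <- w b] | b <- enum 'F_p].
have WE m : (0 < m)%N -> \sum_(z <- W) z ^+ m =
    - \sum_(z <- fixed_points p K m.*2) chi (closure_norm emb (0 :: s) m.*2 (z ^+ p - z)).
  move=> m0; have m20 : (0 < m.*2)%N by rewrite double_gt0.
  rewrite big_flatten big_map -(closure_sum_total p_pr emb chi psiP psi1) // -sumrN big_enum /=.
  apply: eq_bigr => b _; rewrite wE // opprK big_map; apply: eq_bigr => z _.
  by rewrite -exprM mul2n.
have p0 : (0 : algC) < p%:R by rewrite ltr0n prime_gt0.
have Wp : forall z, z \in W -> `|z| <= p%:R.
  apply: (power_sums_bound p0) => m m0; rewrite WE // normrN.
  exact: (closure_sum_bound p_pr p_gt2 emb chiP chi1 us m0).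
have wp z : z \in w c -> `|z| <= sqrtC p%:R.
  move=> zw; have : `|z ^+ 2| <= p%:R.
    apply: Wp; apply/flattenP; exists [seq y ^+ 2 | y <- w c].
      by apply/mapP; exists c; rewrite ?mem_enum.
    by apply/mapP; exists z.
  by rewrite normrX -{1}(sqrtCK p%:R) ler_pXn2r ?nnegrE ?sqrtC_ge0 ?ler0n.
have -> : \sum_(x : 'F_p) chi (\prod_(a <- 0 :: s) (x + a)) * psi (c * x) = S c 1%N.
  have perm : perm_eq (fixed_points p K 1) [seq emb y | y <- enum 'F_p].
    apply: uniq_perm; rewrite ?uniq_fixed_points //.
      by rewrite map_inj_uniq ?enum_uniq //; apply: fmorph_inj.
    move=> x; rewrite mem_fixed_points // expn1; apply/eqP/mapP => [xp|[y _ ->]].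
      by have [y <-] := frobenius_fixed p_pr emb xp; exists y; rewrite ?mem_enum.
    by rewrite -rmorphXn; have := expf_card y; rewrite card_Fp // => ->.
  rewrite /S /closure_sum (perm_big _ perm) /= big_map big_enum /=.
  (* The norm involves a - x and the trace enters with a minus sign; x -> -x repairs both. *)
  rewrite (reindex_inj oppr_inj) /=; apply: eq_bigr => y _.
  have yp : (emb y) ^+ (p ^ 1) = emb y.
    by rewrite expn1 -rmorphXn; have := expf_card y; rewrite card_Fp // => ->.
  rewrite dirichlet_orbit //; congr (chi _ * psi (c * - _)).
    apply: (fmorph_inj emb); rewrite closure_norm_emb // /geom big_ord1 expr1.
    rewrite rmorph_prod; apply: eq_bigr => a _.
    by rewrite rmorphD rmorphN /= addrC.
  by rewrite /trace big_ord1 expn0 expr1 embK.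
rewrite /S wE // normrN; apply: le_trans (ler_norm_sum _ _ _) _.
apply: (@le_trans _ _ (\sum_(z <- w c) sqrtC p%:R)).
  rewrite big_seq [X in _ <= X]big_seq; apply: ler_sum => z zw.
  by rewrite expr1 wp.
rewrite big_const_seq count_predT iter_addr_0 -[sqrtC _ *+ _]mulr_natl ler_wpM2r ?sqrtC_ge0 ?ler0n //.
by rewrite ler_nat sw.
Qed.

(** Translating by one of the shifts makes that shift 0, at the cost of a factor of modulus 1. *)
Theorem weil_bound (s : seq 'F_p) (c : 'F_p) : uniq s -> (0 < size s)%N ->
  `|\sum_(x : 'F_p) chi (\prod_(a <- s) (x + a)) * psi (c * x)|
  <= (size s)%:R * sqrtC p%:R.
Proof.
case: s => // a s us _; pose s' := [seq b - a | b <- s].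
have us' : uniq (0 :: s').
  have := us; rewrite -(map_inj_uniq (addIr (- a))) /= subrr //.
have [_ psiD] := psiP.
have -> : \sum_(x : 'F_p) chi (\prod_(b <- a :: s) (x + b)) * psi (c * x) =
   psi (- (c * a)) * \sum_(x : 'F_p) chi (\prod_(b <- 0 :: s') (x + b)) * psi (c * x).
  rewrite mulr_sumr (reindex_inj (addIr (- a))) /=; apply: eq_bigr => x _.
  rewrite mulrDr psiD mulrN [RHS]mulrCA [psi (c * x) * _]mulrC; congr (chi _ * _).
  rewrite !big_cons big_map subrK addr0; congr (_ * _).
  by apply: eq_bigr => b _; rewrite [b - a]addrC addrA.
rewrite normrM (add_char_norm p_pr psiP) mul1r.
by have := weil_bound0 c us'; rewrite /= size_map.
Qed.
End Weil.

(** * Character sums with factorials *)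

Lemma sum_sqr_le (n : nat) (x : nat -> algC) (N : nat) :
  (forall i, 0 <= x i) ->
  (\sum_(n <= i < n + N) x i) ^+ 2 <= N%:R * \sum_(n <= i < n + N) x i ^+ 2.
Proof.
move=> x0; elim: N => [|N IH].
  by rewrite addn0 big_geq // expr0n mul0r.
rewrite addnS !big_nat_recr ?leq_addr //=.
set A := \sum_(n <= i < n + N) x i in IH *; set B := \sum_(n <= i < n + N) _ in IH *.
set y := x _; have y0 : 0 <= y := x0 _.
have A0 : 0 <= A by apply: sumr_ge0 => i _.
have AB : A * y *+ 2 <= B + N%:R * y ^+ 2.
  suff : 0 <= \sum_(n <= i < n + N) (x i - y) ^+ 2.
    rewrite (_ : \sum_(n <= i < n + N) (x i - y) ^+ 2 = B + N%:R * y ^+ 2 - A * y *+ 2).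
      by rewrite subr_ge0.
    rewrite /B /A mulr_suml -sumrMnl.
    have -> : N%:R * y ^+ 2 = \sum_(n <= i < n + N) y ^+ 2.
      by rewrite big_const_nat addKn iter_addr_0 mulr_natl.
    rewrite -big_split /= -sumrB; apply: eq_bigr => i _; ring.
  apply: sumr_ge0 => i _; apply: real_exprn_even_ge0 => //.
  by rewrite realB ?ger0_real.
rewrite -[N.+1]addn1 natrD mulrDl mul1r mulrDr sqrrD.
have -> : N%:R * B + N%:R * y ^+ 2 + (B + y ^+ 2) =
   N%:R * B + (B + N%:R * y ^+ 2) + y ^+ 2 by ring.
by rewrite lerD2r lerD.
Qed.

Section FactorialSums.
Variables (p : nat) (p_pr : prime p) (p_gt2 : (2 < p)%N).
Variables (chi : 'F_p -> algC) (psi : 'F_p -> algC).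
Hypotheses (chiP : mult_char chi) (psiP : add_char psi).
Hypotheses (chi1 : exists2 t, t != 0 & chi t != 1) (psi1 : exists t, psi t != 1).

Lemma natr_Fp_eq m n : (m%:R == n%:R :> 'F_p) = (m == n %[mod p])%N.
Proof. by rewrite -val_eqE /= !val_Fp_nat. Qed.

Lemma count_residue L (x : 'F_p) : (L <= 2 * p)%N ->
  (\sum_(0 <= u < L) ((u%:R : 'F_p)%R == x) <= 2)%N.
Proof.
move=> Lp; rewrite big_mkord; pose A := [pred u : 'I_L | (u%:R : 'F_p) == x].
have -> : (\sum_(u < L) ((u%:R : 'F_p)%R == x) = #|A|)%N.
  by rewrite -sum1_card [RHS]big_mkcond /=; apply: eq_bigr => u _; rewrite inE; case: eqP.
(* An integer below 2p is determined by its residue and by whether it is below p. *)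
have fI : {in A &, injective (fun u : 'I_L => (u < p)%N)}.
  move=> u v; rewrite !inE => /eqP ux /eqP vx uv; apply: val_inj => /=.
  have := natr_Fp_eq u v; rewrite ux vx eqxx => /esym /eqP.
  have hu := leq_trans (ltn_ord u) Lp; have hv := leq_trans (ltn_ord v) Lp.
  case: (ltnP u p) uv => up uv.
    by rewrite !modn_small // -uv.
  have vp : (p <= v)%N by rewrite leqNgt -uv.
  rewrite -{1}(subnK up) -{1}(subnK vp) !modnDr !modn_small ?ltn_subLR ?addnn -?mul2n //.
  by move=> E; rewrite -(subnK up) E subnK.
by rewrite -(card_in_image fI); apply: leq_trans (max_card _) _; rewrite card_bool.
Qed.

Definition diff_sum L (h : 'F_p -> algC) : algC :=
  \sum_(0 <= v < L) \sum_(0 <= u < L) h (u%:R - v%:R).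

Lemma diff_sum_indicator L (x : 'F_p) : (L <= 2 * p)%N ->
  diff_sum L (fun y => (y == x)%:R) <= (2 * L)%:R.
Proof.
move=> Lp; apply: (@le_trans _ _ (\sum_(0 <= v < L) 2%:R)).
  apply: ler_sum => v _.
  have := count_residue (x + v%:R) Lp; rewrite -(ler_nat algC) natr_sum.
  by under eq_bigr => u _ do rewrite -subr_eq.
by rewrite big_const_nat subn0 iter_addr_0 -mulrnA.
Qed.

(** The weight counting pairs of given difference has Fourier coefficients |E(c)|^2 up to
    normalization. Being nonnegative, they sum to the value of the weight at 0, where
    [diff_sum_indicator] applies. *)
Lemma diff_sum_fourier L (h : 'F_p -> algC) (H : algC) : (L <= 2 * p)%N ->
  (forall c, `|\sum_y h y * psi (c * y)| <= H) ->
  `|diff_sum L h| <= H * (2 * L)%:R.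
Proof.
move=> Lp hH; have [psi0 psiD] := psiP.
have p0 : p%:R != 0 :> algC by rewrite pnatr_eq0 -lt0n prime_gt0.
pose E c := \sum_(0 <= u < L) psi (c * u%:R).
pose hh c := \sum_y h y * psi (c * y).
have normE c : `|E c| ^+ 2 = \sum_(0 <= v < L) \sum_(0 <= u < L) psi (c * (v%:R - u%:R)).
  rewrite normCK /E rmorph_sum /= mulr_suml; apply: eq_bigr => v _.
  rewrite mulr_sumr; apply: eq_bigr => u _.
  by rewrite (add_char_conj p_pr psiP) -psiD -mulrN -mulrDr.
have E2 : \sum_c `|E c| ^+ 2 = p%:R * diff_sum L (fun y => (y == 0)%:R).
  under eq_bigr => c _ do rewrite normE.
  rewrite exchange_big /= mulr_sumr; apply: eq_bigr => v _.
  rewrite exchange_big /= mulr_sumr; apply: eq_bigr => u _.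
  rewrite add_char_sum // subr_eq0 [in RHS]subr_eq0 eq_sym.
  by case: eqP; rewrite ?mulr1 ?mulr0.
have inv : p%:R * diff_sum L h = \sum_c hh c * `|E c| ^+ 2.
  transitivity (\sum_(0 <= v < L) \sum_(0 <= u < L) \sum_c hh c * psi (c * (v%:R - u%:R))).
    rewrite mulr_sumr; apply: eq_bigr => v _; rewrite mulr_sumr; apply: eq_bigr => u _.
    under [RHS]eq_bigr => c _ do rewrite /hh mulr_suml.
    rewrite exchange_big /= (bigD1 (u%:R - v%:R)) //= [\sum_(i | i != _) _]big1 ?addr0.
      under eq_bigr => c _ do rewrite -mulrA -psiD -mulrDr -[v%:R - _]opprB subrr mulr0 psi0 mulr1.
      by rewrite sumr_const card_Fp // mulr_natl.
    move=> y yuv; under eq_bigr => c _ do rewrite -mulrA -psiD -mulrDr.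
    rewrite -mulr_sumr add_char_sum //; case: eqP; rewrite ?mulr0 // => /eqP.
    by rewrite -[v%:R - _]opprB subr_eq0 (negPf yuv).
  under [RHS]eq_bigr => c _ do rewrite normE mulr_sumr.
  rewrite [RHS]exchange_big /=; apply: eq_bigr => v _.
  under [RHS]eq_bigr => c _ do rewrite mulr_sumr.
  by rewrite [RHS]exchange_big.
have H0 : 0 <= H := le_trans (normr_ge0 _) (hH 0).
rewrite -(ler_pM2l (_ : 0 < p%:R)) ?ltr0n ?prime_gt0 //.
rewrite -[X in X * `|_|](normr_nat algC) -normrM inv.
apply: le_trans (ler_norm_sum _ _ _) _.
apply: (@le_trans _ _ (\sum_c H * `|E c| ^+ 2)).
  apply: ler_sum => c _; rewrite normrM normrX normr_id ler_wpM2r ?exprn_ge0 //.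
  exact: hH.
rewrite -mulr_sumr E2 mulrCA ler_wpM2l ?ler0n // ler_wpM2l //.
exact: diff_sum_indicator.
Qed.

Definition rising k (x : 'F_p) : 'F_p := \prod_(1 <= i < k.+1) (x + i%:R).

Lemma risingD k m x : (k <= m)%N ->
  rising m x = rising k x * \prod_(k.+1 <= i < m.+1) (x + i%:R).
Proof. by move=> km; rewrite /rising (@big_cat_nat _ _ _ k.+1). Qed.

Lemma fact_rising n k : (n + k)`!%:R = n`!%:R * rising k n%:R :> 'F_p.
Proof.
rewrite /rising; elim: k => [|k IH]; first by rewrite addn0 big_geq // mulr1.
rewrite big_nat_recr // -[(n%:R + k.+1%:R)%R]natrD mulrA -IH mulrC -natrM.
by rewrite addnS factS.
Qed.

(** The common factor [rising k] cancels against its conjugate except at its zeros. This leaves an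
    incomplete sum with m - k distinct linear factors, estimated by Weil, and at most k exceptional
    residues. *)
Lemma off_diagonal L k m : (L <= 2 * p)%N -> (k < m < p)%N ->
  `|diff_sum L (fun x => chi (rising k x) * (chi (rising m x))^*)|
  <= m%:R * sqrtC p%:R * (2 * L)%:R.
Proof.
move=> Lp /andP[km mp]; have [chi0 chi_1 chiM] := chiP.
pose B x := \prod_(i <- [seq j%:R : 'F_p | j <- index_iota k.+1 m.+1]) (x + i).
have BE x : rising m x = rising k x * B x.
  by rewrite (risingD _ (ltnW km)) /B big_map.
have sqrtp1 : 1 <= sqrtC p%:R :> algC.
  by rewrite -[X in X <= _]sqrtC1 ler_sqrtC ?nnegrE ?ler01 ?ler0n // ler1n prime_gt0.
have fE x : chi (rising k x) * (chi (rising m x))^* =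
    (chi (B x))^* - (rising k x == 0)%:R * (chi (B x))^*.
  rewrite BE chiM rmorphM mulrA mult_char_conj //.
  by case: eqP => /= _; rewrite ?mul1r ?mul0r ?subr0 ?subrr.
rewrite [diff_sum _ _](_ : _ = diff_sum L (fun x => (chi (B x))^*)
    - diff_sum L (fun x => (rising k x == 0)%:R * (chi (B x))^*)); last first.
  rewrite /diff_sum -sumrB; apply: eq_bigr => v _; rewrite -sumrB.
  by apply: eq_bigr => u _; rewrite fE.
apply: le_trans (ler_normB _ _) _.
have b1 : `|diff_sum L (fun x => (chi (B x))^*)| <= (m - k)%:R * sqrtC p%:R * (2 * L)%:R.
  apply: diff_sum_fourier => // c.
  rewrite -norm_conjC rmorph_sum /=.
  have -> : \sum_y ((chi (B y))^* * psi (c * y))^* = \sum_y chi (B y) * psi (- c * y).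
    by apply: eq_bigr => y _; rewrite rmorphM /= conjCK (add_char_conj p_pr psiP) mulNr.
  apply: le_trans (weil_bound p_pr p_gt2 chiP psiP chi1 psi1 (- c) _ _) _.
  - rewrite map_inj_in_uniq ?iota_uniq // => i j; rewrite !mem_index_iota => hi hj /eqP.
    by rewrite natr_Fp_eq !modn_small => [/eqP||]; lia.
  - by rewrite size_map size_iota; lia.
  - by rewrite size_map size_iota subSS.
have b2 : `|diff_sum L (fun x => (rising k x == 0)%:R * (chi (B x))^*)| <= k%:R * (2 * L)%:R.
  apply: (@le_trans _ _ (\sum_(1 <= i < k.+1) diff_sum L (fun x => (x == - i%:R)%:R))).
    rewrite /diff_sum [X in _ <= X]exchange_big /=; apply: le_trans (ler_norm_sum _ _ _) _.
    apply: ler_sum => v _; rewrite [X in _ <= X]exchange_big /=; apply: le_trans (ler_norm_sum _ _ _) _.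
    apply: ler_sum => u _; move: (_ - _) => x.
    rewrite normrM normr_nat norm_conjC; have [r0|] := eqVneq (rising k x) 0; last first.
      by rewrite mul0r => _; apply: sumr_ge0 => i _; rewrite ler0n.
    rewrite mul1r; apply: le_trans (mult_char_norm_le1 p_pr chiP _) _.
    move/eqP: r0; rewrite /rising prodf_seq_eq0 => /hasP[i ik /= xi].
    rewrite (big_rem i) //= -addr_eq0 xi lerDl.
    by apply: sumr_ge0 => j _; rewrite ler0n.
  apply: (@le_trans _ _ (\sum_(1 <= i < k.+1) (2 * L)%:R)).
    by apply: ler_sum => i _; apply: diff_sum_indicator.
  by rewrite big_const_nat subn1 iter_addr_0 -mulrnA -natrM mulnC.
apply: le_trans (lerD b1 b2) _; rewrite -mulrDl ler_wpM2r ?ler0n //.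
rewrite -{2}(subnK (ltnW km)) natrD mulrDl lerD2l.
by rewrite ler_peMr ?ler0n.
Qed.

Definition shift_sum b M (x : 'F_p) : algC :=
  \sum_(0 <= k < M) chi (rising k x) * psi (b * k%:R).

(** Each n from 1 to N is a difference u - v with u, v < 2N in at least N ways: take v < N and u = v
    + n. *)
Lemma diff_sum_ge N (h : 'F_p -> algC) : (forall x, 0 <= h x) ->
  N%:R * (\sum_(1 <= n < N.+1) h n%:R) <= diff_sum (2 * N) h.
Proof.
move=> h0; have -> : N%:R * (\sum_(1 <= n < N.+1) h n%:R) =
    \sum_(0 <= v < N) \sum_(v.+1 <= u < v.+1 + N) h (u%:R - v%:R).
  transitivity (\sum_(0 <= v < N) \sum_(1 <= n < N.+1) h n%:R).
    by rewrite big_const_nat subn0 iter_addr_0 mulr_natl.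
  apply: eq_bigr => v _; rewrite -[v.+1]add1n big_addn.
  have -> : (1 + v + N - v = N.+1)%N by rewrite addnAC addnK add1n.
  by apply: eq_bigr => n _; rewrite natrD addrK.
rewrite /diff_sum (@big_cat_nat _ _ _ N 0 (2 * N)) ?leq_pmull //=.
rewrite -[X in X <= _]addr0; apply: lerD; last first.
  by apply: sumr_ge0 => v _; apply: sumr_ge0.
rewrite big_nat [X in _ <= X]big_nat; apply: ler_sum => v /andP[_ vN].
rewrite [X in _ <= X](@big_cat_nat _ _ _ v.+1) /= ?(leq_trans vN) ?leq_pmull //.
rewrite [X in _ <= _ + X](@big_cat_nat _ _ _ (v.+1 + N)) /= ?leq_addr //; last first.
  by rewrite mul2n -addnn leq_add2r.
by rewrite addrCA lerDl addr_ge0 // sumr_ge0.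
Qed.

Lemma diff_sum_norm_le L (h : 'F_p -> algC) : (forall x, `|h x| <= 1) ->
  `|diff_sum L h| <= (L * L)%:R.
Proof.
move=> h1; apply: le_trans (ler_norm_sum _ _ _) _.
apply: (@le_trans _ _ (\sum_(0 <= v < L) L%:R)); last first.
  by rewrite big_const_nat subn0 iter_addr_0 -mulrnA.
apply: ler_sum => v _; apply: le_trans (ler_norm_sum _ _ _) _.
apply: (@le_trans _ _ (\sum_(0 <= u < L) 1)); first by apply: ler_sum => u _.
by rewrite big_const_nat subn0 iter_addr_0.
Qed.

Lemma diff_sum_conj L (h : 'F_p -> algC) :
  `|diff_sum L (fun x => (h x)^*)| = `|diff_sum L h|.
Proof.
rewrite -[RHS]norm_conjC /diff_sum rmorph_sum; congr `|_|; apply: eq_bigr => v _.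
by rewrite rmorph_sum.
Qed.

Lemma shift_sum_mean_square N M b : (0 < N < p)%N -> (M < p)%N ->
  \sum_(1 <= n < N.+1) `|shift_sum b M n%:R| ^+ 2 <=
  4%:R * (N * M)%:R + 4%:R * (M ^ 3)%:R * sqrtC p%:R.
Proof.
move=> /andP[N0 Np] Mp; have Lp : (2 * N <= 2 * p)%N by rewrite leq_mul2l ltnW.
have sp0 : 0 <= sqrtC p%:R :> algC by rewrite sqrtC_ge0 ler0n.
rewrite -(ler_pM2l (_ : 0 < N%:R)) ?ltr0n //.
apply: le_trans (diff_sum_ge N (h := fun x => `|shift_sum b M x| ^+ 2) _) _.
  by move=> x; rewrite exprn_ge0.
pose c k m x := chi (rising k x) * (chi (rising m x))^*.
have D0 : 0 <= diff_sum (2 * N) (fun x => `|shift_sum b M x| ^+ 2).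
  by apply: sumr_ge0 => v _; apply: sumr_ge0 => u _; rewrite exprn_ge0.
rewrite -[X in X <= _](ger0_norm D0).
have -> : diff_sum (2 * N) (fun x => `|shift_sum b M x| ^+ 2) =
    \sum_(0 <= k < M) \sum_(0 <= m < M)
      (psi (b * k%:R) * (psi (b * m%:R))^*) * diff_sum (2 * N) (c k m).
  rewrite /diff_sum.
  under [RHS]eq_bigr => k _.
    under eq_bigr => m _ do rewrite mulr_sumr.
    rewrite exchange_big /=; over.
  rewrite [RHS]exchange_big /=; apply: eq_bigr => v _.
  under [RHS]eq_bigr => k _.
    under eq_bigr => m _ do rewrite mulr_sumr.
    rewrite exchange_big /=; over.
  rewrite [RHS]exchange_big /=; apply: eq_bigr => u _.
  rewrite normCK /shift_sum rmorph_sum /= mulr_suml; apply: eq_bigr => k _.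
  rewrite mulr_sumr; apply: eq_bigr => m _.
  by rewrite rmorphM /= /c; ring.
(* The diagonal is estimated trivially by (2N)^2, the rest by Weil. Summed over k, m and divided by
   N, these give the two terms of the statement. *)
pose T (k m : nat) : algC := (k == m)%:R * (2 * N * (2 * N))%:R + M%:R * sqrtC p%:R * (2 * (2 * N))%:R.
have T0 : 0 <= M%:R * sqrtC p%:R * (2 * (2 * N))%:R :> algC by rewrite !mulr_ge0 ?ler0n.
have off k m : (k < m < M)%N -> `|diff_sum (2 * N) (c k m)| <= T k m.
  case/andP=> km mM; rewrite /T (ltn_eqF km) mul0r add0r.
  apply: le_trans (off_diagonal Lp _) _; first by rewrite km (ltn_trans mM).
  by rewrite ler_wpM2r ?ler0n // ler_wpM2r // ler_nat ltnW.
apply: (@le_trans _ _ (\sum_(0 <= k < M) \sum_(0 <= m < M) T k m)).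
  apply: le_trans (ler_norm_sum _ _ _) _.
  rewrite big_nat [X in _ <= X]big_nat; apply: ler_sum => k /andP[_ kM].
  apply: le_trans (ler_norm_sum _ _ _) _.
  rewrite big_nat [X in _ <= X]big_nat; apply: ler_sum => m /andP[_ mM].
  rewrite !normrM norm_conjC !(add_char_norm p_pr psiP) !mul1r.
  case: (ltngtP k m) => km; first by apply: off; rewrite km.
    have -> : `|diff_sum (2 * N) (c k m)| = `|diff_sum (2 * N) (c m k)|.
      rewrite -diff_sum_conj; congr `|_|; apply: eq_bigr => v _; apply: eq_bigr => u _.
      by rewrite /c rmorphM /= conjCK mulrC.
    by rewrite /T eq_sym; apply: off; rewrite km.
  rewrite /T km eqxx mul1r -[X in X <= _]addr0; apply: lerD => //.
  apply: diff_sum_norm_le => x; rewrite /c normrM norm_conjC.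
  by rewrite mulr_ile1 // (mult_char_norm_le1 p_pr chiP).
rewrite le_eqVlt; apply/orP; left; apply/eqP.
under eq_bigr => k _ do rewrite big_split /= -mulr_suml.
rewrite big_split /= -mulr_suml.
have -> : \sum_(0 <= k < M) \sum_(0 <= m < M) (k == m)%:R = M%:R :> algC.
  transitivity (\sum_(0 <= k < M) (1 : algC)); last first.
    by rewrite big_const_nat subn0 iter_addr_0.
  apply: eq_big_nat => k kM; rewrite (bigD1_seq k) ?mem_index_iota ?iota_uniq //=.
  rewrite eqxx big1 ?addr0 // => m mk; by rewrite eq_sym (negPf mk).
rewrite !big_const_nat !subn0 !iter_addr_0 -mulrnA -[_ *+ (M * M)]mulr_natr natrX !natrM.
ring.
Qed.

(** Moving the range of summation by k changes the sum by at most 2k, since only the ends differ;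
    averaging over k < M costs at most 2M^2 in total. *)
Lemma factorial_sum_shift N M b :
  M%:R * `|\sum_(1 <= n < N.+1) chi n`!%:R * psi (b * n%:R)| <=
  \sum_(1 <= n < N.+1) `|shift_sum b M n%:R| + (2 * M * M)%:R.
Proof.
have [_ _ chiM] := chiP; have [_ psiD] := psiP.
pose a n := chi n`!%:R * psi (b * n%:R); set S := \sum_(1 <= n < N.+1) _.
have a1 n : `|a n| <= 1.
  by rewrite normrM (add_char_norm p_pr psiP) mulr1 (mult_char_norm_le1 p_pr chiP).
have sum1 i j : `|\sum_(i <= n < j) a n| <= (j - i)%:R.
  apply: le_trans (ler_norm_sum _ _ _) _.
  apply: (@le_trans _ _ (\sum_(i <= n < j) 1)); first by apply: ler_sum => n _.
  by rewrite big_const_nat iter_addr_0.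
have shift k : `|S - \sum_(1 <= n < N.+1) a (n + k)%N| <= (2 * k)%:R.
  have E1 : \sum_(1 <= n < (N + k).+1) a n = S + \sum_(N.+1 <= n < (N + k).+1) a n.
    by rewrite (@big_cat_nat _ _ _ N.+1) // ltnS leq_addr.
  have E2 : \sum_(1 <= n < (N + k).+1) a n =
      \sum_(1 <= n < k.+1) a n + \sum_(1 <= n < N.+1) a (n + k)%N.
    rewrite (@big_cat_nat _ _ _ k.+1) //=; last by rewrite ltnS leq_addl.
    by congr (_ + _); rewrite -[k.+1]add1n big_addn -addSn addnK.
  have -> : S - \sum_(1 <= n < N.+1) a (n + k)%N =
      \sum_(1 <= n < k.+1) a n - \sum_(N.+1 <= n < (N + k).+1) a n.
    by apply/eqP; rewrite subr_eq addrAC eq_sym subr_eq -E2 E1.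
  apply: le_trans (ler_normB _ _) _; apply: le_trans (lerD (sum1 _ _) (sum1 _ _)) _.
  by rewrite -natrD ler_nat subn1 subSS addKn addnn mul2n.
have aE n : \sum_(0 <= k < M) a (n + k)%N = a n * shift_sum b M n%:R.
  rewrite /shift_sum mulr_sumr; apply: eq_bigr => k _.
  by rewrite /a fact_rising chiM natrD mulrDr psiD; ring.
have -> : M%:R * `|S| = `|\sum_(0 <= k < M) S|.
  by rewrite big_const_nat subn0 iter_addr_0 -[S *+ M]mulr_natl normrM normr_nat.
have -> : \sum_(0 <= k < M) S =
    \sum_(1 <= n < N.+1) a n * shift_sum b M n%:R +
    \sum_(0 <= k < M) (S - \sum_(1 <= n < N.+1) a (n + k)%N).
  under [X in _ = X + _]eq_bigr => n _ do rewrite -aE.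
  rewrite [X in _ = X + _]exchange_big /= -[RHS]big_split /=; apply: eq_bigr => k _.
  by rewrite addrC subrK.
apply: le_trans (ler_normD _ _) _; apply: lerD.
  apply: le_trans (ler_norm_sum _ _ _) _; apply: ler_sum => n _.
  by rewrite normrM ler_piMl.
apply: le_trans (ler_norm_sum _ _ _) _.
apply: (@le_trans _ _ (\sum_(0 <= k < M) (2 * M)%:R)).
  rewrite big_nat [X in _ <= X]big_nat; apply: ler_sum => k /andP[_ kM].
  by apply: le_trans (shift k) _; rewrite ler_nat leq_mul2l ltnW.
by rewrite big_const_nat subn0 iter_addr_0 -mulrnA.
Qed.
End FactorialSums.

Section FactorialSumBound.
Variables (p : nat) (p_pr : prime p) (p_gt2 : (2 < p)%N).
Variables (chi : 'F_p -> algC) (psi : 'F_p -> algC).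
Hypotheses (chiP : mult_char chi) (psiP : add_char psi).
Hypotheses (chi1 : exists2 t, t != 0 & chi t != 1) (psi1 : exists t, psi t != 1).

Lemma factorial_sum_trivial N b :
  `|\sum_(1 <= n < N.+1) chi n`!%:R * psi (b * n%:R)| <= N%:R.
Proof.
apply: le_trans (ler_norm_sum _ _ _) _.
apply: (@le_trans _ _ (\sum_(1 <= n < N.+1) 1)).
  apply: ler_sum => n _.
  by rewrite normrM (add_char_norm p_pr psiP) mulr1 (mult_char_norm_le1 p_pr chiP).
by rewrite big_const_nat subn1 iter_addr_0.
Qed.

(** M of size N^(1/2) p^(-1/4) balances NM against M^3 sqrt p. It is taken maximal with M^4 p <=
    N^2, so that N^2 < (M + 1)^4 p <= (2M)^4 p. *)
Lemma shift_length N : (0 < N < p)%N -> (p <= N ^ 2)%N ->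
  exists M, [/\ (0 < M < p)%N, (M ^ 4 * p <= N ^ 2)%N & (N ^ 2 <= 16 * M ^ 4 * p)%N].
Proof.
move=> /andP[N0 Np] pN; have p0 := prime_gt0 p_pr.
have ex : exists M, (M ^ 4 * p <= N ^ 2)%N by exists 0%N.
have ub M : (M ^ 4 * p <= N ^ 2)%N -> (M <= N)%N.
  move=> h; rewrite leqNgt; apply/negP => NM.
  have h1 : (N.+1 ^ 4 <= M ^ 4)%N by rewrite leq_exp2r.
  have h2 : (M ^ 4 <= M ^ 4 * p)%N by rewrite leq_pmulr.
  have h3 : (N ^ 2 < N.+1 ^ 4)%N.
    by apply: (@leq_trans (N.+1 ^ 2)%N); rewrite ?ltn_exp2r // leq_exp2l.
  by move: (leq_trans h3 (leq_trans h1 (leq_trans h2 h))); rewrite ltnn.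
case: (ex_maxnP ex ub) => M hM Mmax.
have M0 : (0 < M)%N by apply: Mmax; rewrite exp1n mul1n.
exists M; split => //; first by rewrite M0 (leq_ltn_trans (ub _ hM)).
have hS : (N ^ 2 < M.+1 ^ 4 * p)%N.
  by rewrite ltnNge; apply/negP => /Mmax; rewrite ltnn.
apply: leq_trans (ltnW hS) _; rewrite leq_mul2r; apply/orP; right.
rewrite (_ : 16 = 2 ^ 4)%N // -expnMn leq_exp2r //; lia.
Qed.

Lemma factorial_sum_bound N b : (0 < N < p)%N ->
  `|\sum_(1 <= n < N.+1) chi n`!%:R * psi (b * n%:R)| ^+ 8 <= (48 ^ 4 * N ^ 6 * p)%:R.
Proof.
move=> NNp; have /andP[N0 Np] := NNp.
have := factorial_sum_trivial N b.
have := fun M => factorial_sum_shift p_pr chiP psiP N M b.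
set S := `|_|; move=> shift triv; have S0 : 0 <= S by apply: normr_ge0.
(* For N^2 < p the trivial bound N already gives N^8 <= N^6 p. *)
have [Np2|pN] := ltnP (N ^ 2) p.
  apply: (@le_trans _ _ (N%:R ^+ 8)); first by rewrite ler_pXn2r ?nnegrE ?ler0n.
  rewrite -natrX ler_nat (expnD N 6 2) -mulnA.
  apply: (@leq_trans (N ^ 6 * p)%N); first by rewrite leq_mul2l (ltnW Np2) orbT.
  by rewrite leq_pmull.
have [M [/andP[M0 Mp] M4 NM]] := shift_length NNp pN.
have M0C : 0 < M%:R :> algC by rewrite ltr0n.
have NC : 0 < N%:R :> algC by rewrite ltr0n.
set Y := \sum_(1 <= n < N.+1) `|shift_sum chi psi b M n%:R|.
have Y0 : 0 <= Y by apply: sumr_ge0.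
have Msp : (M ^ 2)%:R * sqrtC p%:R <= N%:R :> algC.
  rewrite -(ler_pXn2r (_ : 0 < 2)%N) ?nnegrE ?mulr_ge0 ?sqrtC_ge0 ?ler0n //.
  by rewrite exprMn sqrtCK -!natrX -natrM ler_nat -expnM.
have Y2 : Y ^+ 2 <= 8%:R * (N ^ 2 * M)%:R.
  have := @sum_sqr_le 1 (fun n => `|shift_sum chi psi b M n%:R|) N (fun n => normr_ge0 _).
  rewrite add1n -/Y => /le_trans; apply.
  apply: le_trans (ler_wpM2l (ler0n _ _)
    (shift_sum_mean_square p_pr p_gt2 chiP psiP chi1 psi1 b NNp Mp)) _.
  have -> : 8%:R * (N ^ 2 * M)%:R = N%:R * (4%:R * (N * M)%:R + 4%:R * M%:R * N%:R) :> algC.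
    by rewrite !natrM ?natrX; ring.
  apply: ler_wpM2l; rewrite ?ler0n //; apply: lerD => //.
  have -> : 4%:R * (M ^ 3)%:R * sqrtC p%:R =
     4%:R * M%:R * ((M ^ 2)%:R * sqrtC p%:R) :> algC by rewrite !natrX; ring.
  by apply: ler_wpM2l => //; rewrite mulr_ge0 ?ler0n.
have X2 : (M%:R * S) ^+ 2 <= 24%:R * (N ^ 2 * M)%:R.
  apply: (@le_trans _ _ ((Y + (2 * M * M)%:R) ^+ 2)).
    by rewrite ler_pXn2r ?nnegrE ?mulr_ge0 ?addr_ge0 ?ler0n.
  apply: (@le_trans _ _ (2%:R * Y ^+ 2 + 2%:R * ((2 * M * M)%:R) ^+ 2)).
    rewrite -subr_ge0.
    have -> : 2%:R * Y ^+ 2 + 2%:R * (2 * M * M)%:R ^+ 2 - (Y + (2 * M * M)%:R) ^+ 2 =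
      (Y - (2 * M * M)%:R) ^+ 2 by ring.
    by rewrite real_exprn_even_ge0 // realB ?ger0_real ?ler0n.
  have -> : 24%:R * (N ^ 2 * M)%:R = 2%:R * (8%:R * (N ^ 2 * M)%:R) + (8 * (N ^ 2 * M))%:R :> algC.
    by rewrite !natrM; ring.
  apply: lerD; first by rewrite ler_wpM2l ?ler0n.
  rewrite -natrX -natrM ler_nat (_ : 2 * (2 * M * M) ^ 2 = 8 * M ^ 4)%N; last by ring.
  rewrite leq_mul2l /=; apply: (@leq_trans (M ^ 4 * p)%N); first by rewrite leq_pmulr ?prime_gt0.
  by apply: leq_trans M4 _; rewrite leq_pmulr.
have MS : M%:R * S ^+ 2 <= (24 * N ^ 2)%:R.
  rewrite -(ler_pM2l M0C); have -> : M%:R * (M%:R * S ^+ 2) = (M%:R * S) ^+ 2 by ring.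
  by apply: le_trans X2 _; rewrite -!natrM ler_nat; nia.
have M4S : (M ^ 4)%:R * S ^+ 8 <= (24 ^ 4 * N ^ 8)%:R.
  have -> : (M ^ 4)%:R * S ^+ 8 = (M%:R * S ^+ 2) ^+ 4 by rewrite natrX; ring.
  have -> : (24 ^ 4 * N ^ 8)%:R = (24 * N ^ 2)%:R ^+ 4 :> algC.
    by rewrite -natrX expnMn -expnM.
  by rewrite ler_pXn2r ?nnegrE ?mulr_ge0 ?exprn_ge0 ?ler0n.
(* M is eliminated through N^2 <= 16 M^4 p, and 16 times 24^4 is 48^4. *)
rewrite -(ler_pM2l (_ : 0 < (N ^ 2)%:R)) ?ltr0n ?expn_gt0 ?N0 //.
apply: (@le_trans _ _ ((16 * p)%:R * ((M ^ 4)%:R * S ^+ 8))).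
  by rewrite mulrA -natrM ler_wpM2r ?exprn_ge0 // ler_nat mulnAC.
apply: le_trans (ler_wpM2l (ler0n _ _) M4S) _.
rewrite -!natrM ler_nat.
by rewrite (_ : N ^ 2 * (48 ^ 4 * N ^ 6 * p) = 16 * p * (24 ^ 4 * N ^ 8))%N //; ring.
Qed.
End FactorialSumBound.

(** * Compositions *)

Lemma add_char_exists p : prime p ->
  exists2 psi : 'F_p -> algC, add_char psi & exists t, psi t != 1.
Proof.
move=> p_pr; have [z zP] := C_prim_root_exists (prime_gt0 p_pr).
exists (fun x => z ^+ (x : nat)); first split.
- by rewrite expr0.
- move=> x y; rewrite -exprD -(prim_expr_mod zP (x + y)); congr (z ^+ _).
  by rewrite -val_Fp_nat // natrD !natr_Zp.
exists 1; rewrite (_ : nat_of_ord (1%R : 'F_p) = 1%N) // expr1.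
apply/eqP => z1; have := prim_order_dvd zP 1; rewrite z1 eqxx dvdn1 => /eqP p1.
by have := prime_gt1 p_pr; rewrite p1.
Qed.

Lemma mult_char_family p : prime p -> (2 < p)%N ->
  exists chi : nat -> 'F_p -> algC,
    [/\ forall j, mult_char (chi j),
        forall x, x != 0 -> chi 0%N x = 1,
        forall j, (0 < j < p.-1)%N -> exists2 t, t != 0 & chi j t != 1 &
        forall x a, x != 0 -> a != 0 ->
          \sum_(0 <= j < p.-1) chi j x * (chi j a)^* = p.-1%:R * (x == a)%:R].
Proof.
move=> p_pr p_gt2; have q0 : (0 < p.-1)%N by lia.
have [g gP] : exists g : 'F_p, p.-1.-primitive_root g.
  have := @has_prim_root _ p.-1 (enum [pred x : 'F_p | x != 0]) q0.
  case/(_ _ (enum_uniq _) _)/hasP.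
  - apply/allP => x; rewrite mem_enum inE => x0; apply/unity_rootP.
    have : x ^+ p.-1.+1 = x.
      by rewrite prednK ?prime_gt0 //; have := expf_card x; rewrite card_Fp.
    by rewrite exprSr -[RHS]mul1r => /(mulIf x0).
  - by rewrite -cardE cardC1 card_Fp.
  by move=> g _ gP; exists g.
have g0 : g != 0.
  apply/eqP => g0; have := prim_expr_order gP; rewrite g0 expr0n -leqn0 leqNgt q0.
  by move/esym/eqP; rewrite oner_eq0.
have [z zP] := C_prim_root_exists q0.
(* The discrete logarithm to base [g]; its default value at 0 is harmless because [chi] treats 0
   separately. *)
pose dl (x : 'F_p) : nat := odflt (Ordinal q0) [pick i : 'I_p.-1 | x == g ^+ i].
have dlK x : x != 0 -> g ^+ dl x = x.
  move=> x0; have : x ^+ p.-1 = 1.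
    have : x ^+ p.-1.+1 = x.
      by rewrite prednK ?prime_gt0 //; have := expf_card x; rewrite card_Fp.
    by rewrite exprSr -[RHS]mul1r => /(mulIf x0).
  case/(prim_rootP gP) => i xi; rewrite /dl; case: pickP => [k /eqP -> //|].
  by move/(_ i); rewrite xi eqxx.
have dlE x k : x != 0 -> x = g ^+ k -> z ^+ dl x = z ^+ k.
  move=> x0 xk; apply/eqP; rewrite (eq_prim_root_expr zP) -(eq_prim_root_expr gP).
  by rewrite dlK // xk.
have zn k : `|z ^+ k| = 1.
  have : `|z| ^+ p.-1 == 1 by rewrite -normrX (prim_expr_order zP) normr1.
  by rewrite pexpr_eq1 // normrX => /eqP ->; rewrite expr1n.
pose chi j (x : 'F_p) : algC := if x == 0 then 0 else (z ^+ dl x) ^+ j.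
exists chi; split.
- move=> j; split; rewrite /chi ?eqxx ?oner_eq0 //.
    by rewrite (dlE 1 0%N) ?oner_eq0 ?expr0 ?expr1n.
  move=> x y; rewrite mulf_eq0; case: eqP => [_|/eqP x0] /=; first by rewrite mul0r.
  case: eqP => [_|/eqP y0]; first by rewrite mulr0.
  rewrite (dlE _ (dl x + dl y)%N) ?mulf_neq0 ?exprD ?exprMn //.
  by rewrite !dlK.
- by move=> x x0; rewrite /chi (negPf x0) expr0.
- move=> j /andP[j0 jp]; exists g => //; rewrite /chi (negPf g0) (dlE _ 1%N) //.
  rewrite expr1; apply/eqP => zj; have := prim_order_dvd zP j; rewrite zj eqxx.
  by move/(dvdn_leq j0); rewrite leqNgt jp.
move=> x a x0 a0; rewrite /chi (negPf x0) (negPf a0).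
set u := z ^+ dl x * (z ^+ dl a)^*.
have -> : \sum_(0 <= j < p.-1) (z ^+ dl x) ^+ j * ((z ^+ dl a) ^+ j)^* =
    \sum_(j < p.-1) u ^+ j.
  by rewrite big_mkord; apply: eq_bigr => j _; rewrite rmorphXn -exprMn.
have uq : u ^+ p.-1 = 1.
  rewrite /u exprMn -rmorphXn -!exprM -mulnC exprM (prim_expr_order zP) expr1n mul1r.
  by rewrite mulnC exprM (prim_expr_order zP) expr1n rmorph1.
have u1 : (u == 1) = (x == a).
  have za : z ^+ dl a * (z ^+ dl a)^* = 1 by rewrite -normCK zn expr1n.
  have zc0 : (z ^+ dl a)^* != 0 by rewrite -normr_eq0 norm_conjC zn oner_eq0.
  rewrite -za /u (inj_eq (mulIf zc0)) (eq_prim_root_expr zP) -(eq_prim_root_expr gP).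
  by rewrite !dlK.
move: u1; case: (x == a) => [/eqP ->|u1].
  by rewrite mulr1; under eq_bigr => j _ do rewrite expr1n; rewrite sumr_const card_ord.
rewrite mulr0; apply/eqP; have := subrX1 u p.-1; rewrite uq subrr => /esym/eqP.
by rewrite mulf_eq0 subr_eq0 u1.
Qed.

Lemma natr_fact_neq0 p n : prime p -> (n < p)%N -> n`!%:R != 0 :> 'F_p.
Proof.
move=> p_pr np; rewrite -(dvdn_pcharf (pchar_Fp p_pr)).
elim: n np => [|n IH] np; first by rewrite fact0 dvdn1 gtn_eqF ?prime_gt1.
by rewrite factS Euclid_dvdM // negb_or IH ?gtnNdvd // ltnW.
Qed.

Definition compositions l N : {set {ffun 'I_l -> 'I_N.+1}} :=
  [set n : {ffun 'I_l -> 'I_N.+1} | [forall i, (0 < n i)%N] && ((\sum_(i < l) n i)%N == N)].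

Lemma card_compositions l N : (0 < l)%N -> (0 < N)%N ->
  #|compositions l N| = 'C(N.-1, l.-1).
Proof.
case: l => // m _ N0; have [lN|Nl] := leqP m.+1 N; last first.
  rewrite bin_small; last by rewrite -ltnS prednK.
  apply: eq_card0 => f; rewrite !inE; apply/negP => /andP[/forallP f0 /eqP fN].
  have : (m.+1 <= \sum_(i < m.+1) f i)%N.
    rewrite -{1}[m.+1]card_ord -sum1_card; apply: leq_sum => i _; exact: f0.
  by rewrite fN leqNgt Nl.
(* Subtracting 1 from every part turns compositions into weak compositions of [n]. *)
pose n := (N - m.+1)%N.
have -> : 'C(N.-1, m) = 'C(m + n, m) by congr 'C(_, _); rewrite /n; lia.
rewrite -card_ord_partitions.
pose g (t : m.+1.-tuple 'I_n.+1) : {ffun 'I_m.+1 -> 'I_N.+1} :=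
  [ffun i => inord (tnth t i).+1].
have gE t i : g t i = (tnth t i).+1 :> nat.
  by rewrite ffunE inordK // ltnS; have := ltn_ord (tnth t i); rewrite /n; lia.
have gI : injective g.
  move=> t t' tt'; apply: eq_from_tnth => i; apply: val_inj => /=.
  by apply: succn_inj; rewrite -!gE tt'.
rewrite -(card_imset _ gI); apply: eq_card => f; apply/idP/imsetP.
  rewrite inE => /andP[/forallP f0 /eqP fN].
  have fle i : (f i <= n.+1)%N.
    have : (f i + m <= N)%N.
      apply: (@leq_trans (\sum_(j < m.+1) f j)%N); last by rewrite fN.
      rewrite (bigD1 i) //= leq_add2l.
      have {1}-> : m = (\sum_(j < m.+1 | j != i) 1)%N.
        by rewrite sum1_card cardC1 card_ord.
      by apply: leq_sum => j _; exact: f0.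
    by rewrite /n; lia.
  exists [tuple inord (f i).-1 | i < m.+1]; last first.
    apply/ffunP => i; apply: val_inj => /=; rewrite gE tnth_mktuple inordK.
      by rewrite prednK // f0.
    by rewrite prednK ?fle // f0.
  rewrite inE big_tuple; apply/eqP.
  under eq_bigr => i _ do rewrite tnth_mktuple inordK ?(prednK (f0 i)) ?fle //.
  apply: (@addIn m.+1); rewrite /n subnK //.
  transitivity (\sum_(i < m.+1) (f i).-1 + \sum_(i < m.+1) 1)%N.
    by rewrite sum1_card card_ord.
  rewrite -big_split /= -[RHS]fN; apply: eq_bigr => i _.
  by rewrite addn1 prednK // f0.
case=> t; rewrite inE big_tuple => /eqP tn ->; rewrite inE; apply/andP; split.
  by apply/forallP => i; rewrite gE.
under eq_bigr => i _ do rewrite gE -addn1.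
by rewrite big_split /= tn sum1_card card_ord subnK.
Qed.

Section CompositionSums.
Variables (p : nat) (p_pr : prime p) (p_gt2 : (2 < p)%N).
Variable (psi : 'F_p -> algC).
Hypotheses (psiP : add_char psi) (psi1 : exists t, psi t != 1).
Variables (l N : nat).
Hypotheses (N_gt0 : (0 < N)%N) (lN : (l * N < p)%N) (l_gt0 : (0 < l)%N).

Let Np : (N < p)%N := leq_ltn_trans (leq_pmull N l_gt0) lN.

Definition factorial_sum (chi : 'F_p -> algC) b :=
  \sum_(1 <= n < N.+1) chi n`!%:R * psi (b * n%:R).

Definition composition_sum (chi : 'F_p -> algC) :=
  \sum_(f in compositions l N) chi (\prod_(i < l) (f i)`!)%N%:R.

Lemma composition_sum_fourier chi : mult_char chi ->
  p%:R * composition_sum chi =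
  \sum_b psi (- (b * N%:R)) * factorial_sum chi b ^+ l.
Proof.
move=> [chi0 chi_1 chiM]; have [psi0 psiD] := psiP.
have powE b : factorial_sum chi b ^+ l = \sum_(f : {ffun 'I_l -> 'I_N.+1})
    [forall i, (0 < f i)%N]%:R * chi (\prod_(i < l) (f i)`!)%N%:R * psi (b * (\sum_(i < l) f i)%N%:R).
  have -> : factorial_sum chi b =
      \sum_(k < N.+1) (0 < k)%N%:R * (chi (k`!)%:R * psi (b * k%:R)).
    rewrite -(big_mkord xpredT (fun k => (0 < k)%N%:R * (chi (k`!)%:R * psi (b * k%:R)))).
    rewrite big_ltn // mul0r add0r; apply: eq_big_nat => k /andP[-> _].
    by rewrite mul1r.
  rewrite -[in LHS](card_ord l) -prodr_const bigA_distr_bigA /=; apply: eq_bigr => f _.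
  rewrite !big_split /= -mulrA; congr (_ * (_ * _)).
  - case: forallP => [f0|nf]; first by rewrite big1 // => i _; rewrite f0.
    have [i fi] : exists i, ~~ (0 < f i)%N by apply/existsP; rewrite -negb_forall; apply/forallP.
    by rewrite (bigD1 i) //= (negPf fi) mul0r.
  - by rewrite natr_prod (big_morph chi chiM chi_1).
  - by rewrite natr_sum mulr_sumr (big_morph psi psiD psi0).
under eq_bigr => b _ do rewrite powE mulr_sumr.
rewrite exchange_big /= /composition_sum mulr_sumr big_mkcond /=.
apply: eq_bigr => f _; rewrite inE.
transitivity (\sum_b [forall i, (0 < f i)%N]%:R * chi (\prod_(i < l) (f i)`!)%N%:R *
    psi (b * ((\sum_(i < l) f i)%N%:R - N%:R))); last first.
  by apply: eq_bigr => b _; rewrite mulrBr psiD mulrA mulrC.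
rewrite -mulr_sumr add_char_sum // subr_eq0 natr_Fp_eq //.
(* Both sides are at most l N < p, so the additive characters detect equality of integers and not
   merely a congruence. *)
have -> : ((\sum_(i < l) f i)%N == N %[mod p])%N = ((\sum_(i < l) f i)%N == N).
  rewrite !modn_small //; apply: leq_ltn_trans lN.
  apply: (@leq_trans (\sum_(i < l) N)%N); last by rewrite sum_nat_const card_ord.
  by apply: leq_sum => i _; rewrite -ltnS.
case: ([forall _, _]) => /=; last by rewrite !mul0r.
by case: eqP; rewrite ?mulr0 // mul1r mulrC.
Qed.

Lemma factorial_sum_mean_square chi : mult_char chi ->
  \sum_b `|factorial_sum chi b| ^+ 2 <= (p * N)%:R.
Proof.
move=> chiP; have [psi0 psiD] := psiP.
have -> : \sum_b `|factorial_sum chi b| ^+ 2 =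
    \sum_(1 <= n < N.+1) \sum_(1 <= m < N.+1)
      (chi n`!%:R * (chi m`!%:R)^* ) * \sum_b psi (b * (n%:R - m%:R)).
  under [RHS]eq_bigr => n _.
    under eq_bigr => m _ do rewrite mulr_sumr.
    rewrite exchange_big /=; over.
  rewrite [RHS]exchange_big /=; apply: eq_bigr => b _.
  rewrite normCK rmorph_sum /= mulr_suml; apply: eq_bigr => n _.
  rewrite mulr_sumr; apply: eq_bigr => m _.
  by rewrite rmorphM /= (add_char_conj p_pr psiP) mulrBr psiD; ring.
apply: (@le_trans _ _ (\sum_(1 <= n < N.+1) p%:R)); last first.
  by rewrite big_const_nat subn1 iter_addr_0 -mulrnA.
rewrite big_nat [X in _ <= X]big_nat; apply: ler_sum => n nN.
rewrite (bigD1_seq n) ?mem_index_iota ?iota_uniq //= [X in _ + X <= _]big1_seq ?addr0.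
  rewrite add_char_sum // subrr eqxx mult_char_conj //.
  by case: (_ != 0); rewrite ?mul1r ?mul0r ?ler0n.
move=> m /andP[mn]; rewrite mem_index_iota => mN.
rewrite add_char_sum // subr_eq0 natr_Fp_eq // !modn_small; try lia.
by rewrite eq_sym (negPf mn) mulr0.
Qed.

(** The uniform bound is applied to l - 2 factors, and Parseval to the remaining two. *)
Lemma composition_sum_bound chi : mult_char chi ->
  (exists2 t, t != 0 & chi t != 1) -> (1 < l)%N ->
  `|composition_sum chi| <= N%:R * (8.-root (48 ^ 4 * N ^ 6 * p)%:R) ^+ (l - 2).
Proof.
move=> chiP chi1 l1; set W := 8.-root _.
have p0 : 0 < p%:R :> algC by rewrite ltr0n prime_gt0.
have W0 : 0 <= W by rewrite rootC_ge0 ?ler0n.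
have fW b : `|factorial_sum chi b| <= W.
  rewrite -(ler_pXn2r (_ : 0 < 8)%N) ?nnegrE // rootCK //.
  by apply: factorial_sum_bound => //; rewrite N_gt0.
rewrite -(ler_pM2l p0) -[X in X * `|_|](normr_nat algC) -normrM.
rewrite composition_sum_fourier //; apply: le_trans (ler_norm_sum _ _ _) _.
apply: (@le_trans _ _ (\sum_b W ^+ (l - 2) * `|factorial_sum chi b| ^+ 2)).
  apply: ler_sum => b _; rewrite normrM (add_char_norm p_pr psiP) mul1r normrX.
  rewrite -{1}(subnK l1) exprD; apply: ler_wpM2r; first by rewrite exprn_ge0.
  by rewrite lerXn2r ?nnegrE.
rewrite -mulr_sumr mulrC [in X in _ <= X]mulrA -natrM; apply: ler_wpM2r.
  by rewrite exprn_ge0.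
exact: factorial_sum_mean_square.
Qed.
End CompositionSums.

Definition nat_dist m n := ((m - n) + (n - m))%N.

Lemma norm_natrB (R : numDomainType) m n : `|m%:R - n%:R| = (nat_dist m n)%:R :> R.
Proof.
rewrite /nat_dist.
wlog nm : m n / (n <= m)%N.
  move=> H; case/orP: (leq_total n m) => h; first exact: H.
  by rewrite distrC H // addnC.
by rewrite -natrB // normr_nat (eqP (nm : (n - m == 0)%N)) addn0.
Qed.

Definition composition_solutions l p (a : 'F_p) N :=
  [set f in compositions l N | (\prod_(i < l) (f i)`!)%N%:R == a].

(** As N < p, no factorial vanishes modulo p, so the principal character contributes exactly the
    binomial coefficient. Multiplying by p - 1 and taking eighth powers makes the statement purely
    integral. *)
Lemma composition_solutions_bound p l N (a : 'F_p) :
  prime p -> (2 < p)%N -> (0 < N)%N -> (l * N < p)%N -> (1 < l)%N -> a != 0 ->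
  (nat_dist (p.-1 * #|composition_solutions l a N|) 'C(N.-1, l.-1) ^ 8 <=
   (p.-1 * N) ^ 8 * (48 ^ 4 * N ^ 6 * p) ^ (l - 2))%N.
Proof.
move=> p_pr p_gt2 N0 lN l1 a0.
set x := (p.-1 * _)%N; set y := 'C(_, _).
have [psi psiP psi1] := add_char_exists p_pr.
have [chi [chiP chi_0 chi1 chi_orth]] := mult_char_family p_pr p_gt2.
have Np : (N < p)%N by apply: leq_ltn_trans lN; rewrite leq_pmull // ltnW.
set Z := (48 ^ 4 * N ^ 6 * p)%N.
have prod0 (f : {ffun 'I_l -> 'I_N.+1}) : (\prod_(i < l) (f i)`!)%N%:R != 0 :> 'F_p.
  rewrite natr_prod; apply/prodf_neq0 => i _.
  by apply: natr_fact_neq0 => //; apply: leq_ltn_trans Np; rewrite -ltnS.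
have xE : x%:R = \sum_(0 <= j < p.-1) (chi j a)^* * composition_sum l N (chi j) :> algC.
  rewrite /x -sum1_card natrM natr_sum mulr_sumr.
  under [RHS]eq_bigr => j _ do rewrite mulr_sumr.
  rewrite [RHS]exchange_big /= big_mkcond [RHS]big_mkcond /=; apply: eq_bigr => f _.
  rewrite inE; case: (f \in compositions l N) => //=.
  under [RHS]eq_bigr => j _ do rewrite mulrC.
  by rewrite chi_orth //; case: eqP; rewrite ?mulr0.
have yE : y%:R = (chi 0%N a)^* * composition_sum l N (chi 0%N) :> algC.
  rewrite chi_0 // rmorph1 mul1r /y -card_compositions //; last exact: ltnW.
  rewrite -sum1_card natr_sum; apply: eq_bigr => f _; by rewrite chi_0.
have q0 : (0 < p.-1)%N by lia.
have bnd : `|x%:R - y%:R| <= (p.-1 * N)%:R * (8.-root Z%:R) ^+ (l - 2) :> algC.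
  rewrite xE yE big_ltn // addrC addKr; apply: le_trans (ler_norm_sum _ _ _) _.
  set B := N%:R * (8.-root Z%:R) ^+ (l - 2) : algC.
  have B0 : 0 <= B by rewrite mulr_ge0 ?exprn_ge0 ?rootC_ge0 ?ler0n.
  apply: (@le_trans _ _ (\sum_(1 <= j < p.-1) B)).
    rewrite big_nat [X in _ <= X]big_nat; apply: ler_sum => j jp.
    rewrite normrM norm_conjC mult_char_norm // mul1r.
    by apply: (composition_sum_bound p_pr p_gt2 psiP psi1) => //; [exact: ltnW|exact: chi1].
  rewrite big_const_nat iter_addr_0 natrM -mulrA -/B -[B *+ _]mulr_natl.
  by apply: ler_wpM2r => //; rewrite ler_nat leq_subr.
have := bnd; rewrite norm_natrB => {}bnd.
rewrite -(ler_nat algC) natrX.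
apply: (@le_trans _ _ (((p.-1 * N)%:R * (8.-root Z%:R) ^+ (l - 2)) ^+ 8)).
  by rewrite lerXn2r ?nnegrE ?mulr_ge0 ?exprn_ge0 ?rootC_ge0 ?ler0n.
by rewrite exprMn exprAC rootCK // -!natrX -natrM.
Qed.

(* Passage to real numbers and the final estimate *)
From mathcomp Require Import all_classical all_reals all_analysis.

Lemma G_composition_solutions p l (a : 'F_p) N :
  G l a N = #|composition_solutions l a N|.
Proof. by apply: eq_card => f; rewrite !inE andbA. Qed.

Lemma powR_expn (R : realType) (x r : R) (m k : nat) : 0 <= x -> r * m%:R = k%:R ->
  (x `^ r) ^+ m = x ^+ k.
Proof. by move=> x0 rm; rewrite -powR_mulrn ?powR_ge0 // -powRrM rm powR_mulrn. Qed.

(** From ln(1/n) <= 1/n - 1 and n >= 3. *)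
Lemma ln_ge_two_thirds (R : realType) (n : nat) : (2 < n)%N -> 2 / 3 <= ln n%:R :> R.
Proof.
move=> n3; have n0 : 0 < n%:R :> R by rewrite ltr0n; lia.
have n3R : 3 <= n%:R :> R by rewrite ler_nat.
have := @le_ln1Dx R (n%:R^-1 - 1); rewrite [1 + _]addrC subrK lnV ?posrE // => h.
have i3 : n%:R^-1 <= 1 / 3 :> R by rewrite ler_pdivlMr // mulrC ler_pdivrMr ?mul1r.
have i0 : 0 < n%:R^-1 :> R by rewrite invr_gt0.
by have := h ltac:(lra); lra.
Qed.

(** With k = l - 2, [x] in the role of p - 1 and [L] in that of ln p, the right side splits into a
    fixed block and a k-th power. In the latter, the surplus 48^4 outweighs L^2 >= 4/9. *)
Lemma power_comparison (R : realType) (x n q L : R) (k : nat) :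
  0 <= x -> 1 <= n -> 1 <= q -> 2 / 3 <= L ->
  (x * n) ^+ 8 * (48 ^+ 4 * n ^+ 6 * q) ^+ k <=
  48 ^+ ((k + 2) * 8) * (n ^+ (6 * (k + 2)) * q ^+ (k + 2 + 6) * L ^+ (2 * k)) * x ^+ 8.
Proof.
move=> x0 n1 q1 L0; have n0 : 0 <= n by lra.
have q0 : 0 <= q by lra.
have -> : 48 ^+ ((k + 2) * 8) * (n ^+ (6 * (k + 2)) * q ^+ (k + 2 + 6) * L ^+ (2 * k)) * x ^+ 8 =
    (48 ^+ 16 * n ^+ 12 * q ^+ 8 * x ^+ 8) * (48 ^+ 8 * n ^+ 6 * q * L ^+ 2) ^+ k.
  have -> : ((k + 2) * 8 = 8 * k + 16)%N by lia.
  have -> : (6 * (k + 2) = 6 * k + 12)%N by lia.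
  have -> : (k + 2 + 6 = k + 8)%N by lia.
  have -> : forall a b c d : R, (a * b * c * d) ^+ k = a ^+ k * b ^+ k * c ^+ k * d ^+ k.
    by move=> a b c d; rewrite !exprMn.
  rewrite (exprD _ (8 * k)) (exprD _ (6 * k)) (exprD _ k) !(exprM _ _ k).
  move: ((48 ^+ 8) ^+ k) ((n ^+ 6) ^+ k) (q ^+ k) ((L ^+ 2) ^+ k) => a b c d; ring.
have n8 : 0 <= n ^+ 8 by rewrite exprn_ge0.
have x8 : 0 <= x ^+ 8 by rewrite exprn_ge0.
apply: ler_pM; rewrite ?exprn_ge0 ?mulr_ge0 ?exprn_ge0 //.
  rewrite exprMn mulrC; apply: ler_wpM2r => //.
  apply: (@le_trans _ _ (n ^+ 12)); first by rewrite ler_weXn2l.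
  rewrite mulrAC ler_peMl ?exprn_ge0 // mulr_ege1 // ?exprn_ege1 //.
  by rewrite ler1n.
apply: lerXn2r; rewrite ?nnegrE ?mulr_ge0 ?exprn_ge0 //; try lra.
have -> : 48 ^+ 8 * n ^+ 6 * q * L ^+ 2 = (48 ^+ 4 * L ^+ 2) * (48 ^+ 4 * n ^+ 6 * q) by ring.
apply: ler_peMl; first by rewrite !mulr_ge0 ?exprn_ge0.
have L2 : 4 / 9 <= L ^+ 2 by nra.
apply: (@le_trans _ _ (48 ^+ 4 * (4 / 9))); first by lra.
by apply: ler_wpM2l => //; rewrite exprn_ge0.
Qed.

Theorem theorem11 (R : realType) (l : nat) (hl : (1 <= l)%N) :
  exists C : R, 0 < C /\
    forall p N : nat, prime p -> odd p -> (1 <= N)%N ->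
      N%:R < p%:R / l%:R :> R ->
      \big[Num.max/0]_(a : 'F_p | a != 0)
        `| (G l a N)%:R - (p%:R - 1)^-1 * 'C(N.-1, l.-1)%:R |
      <= C * (N%:R `^ (3 * l%:R / 4) * p%:R `^ ((l%:R + 6) / 8)
              * (ln p%:R) `^ ((l%:R - 2) / 4)).
Proof.
exists (48 ^+ l); split => [|p N p_pr p_odd N0 NpR]; first by rewrite exprn_gt0.
have p_gt2 := odd_prime_gt2 p_odd p_pr.
have lN : (l * N < p)%N.
  by move: NpR; rewrite ltr_pdivlMr ?ltr0n // -natrM ltr_nat mulnC.
set T := _ * (_ * _ * _).
have p1 : (p%:R - 1 = p.-1%:R :> R) by rewrite -[in LHS](prednK (prime_gt0 p_pr)) -natr1 addrK.
have q0 : 0 < p.-1%:R :> R by rewrite ltr0n; lia.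
have NR : 1 <= N%:R :> R by rewrite ler1n.
have pR : 1 <= p%:R :> R by rewrite ler1n prime_gt0.
have ln0 : 2 / 3 <= ln p%:R :> R := ln_ge_two_thirds R p_gt2.
have ln_ge0 : 0 <= ln p%:R :> R by lra.
have T0 : 0 <= T by rewrite !mulr_ge0 ?powR_ge0 // exprn_ge0.
(* Eighth powers make the exponents of N and p natural. The logarithm keeps its real exponent here,
   since it is negative when l = 1. *)
have T8 : T ^+ 8 = 48 ^+ (l * 8) * (N%:R ^+ (6 * l) * p%:R ^+ (l + 6) *
    ((ln p%:R) `^ ((l%:R - 2) / 4)) ^+ 8).
  rewrite /T !exprMn -exprM; congr (_ * (_ * _ * _)); apply: powR_expn; rewrite ?ler0n //.
    by rewrite natrM; field.
  by rewrite natrD; field.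
apply: bigmax_le => // a a0; rewrite G_composition_solutions p1.
rewrite -(ler_pXn2r (_ : 0 < 8)%N) ?nnegrE // T8.
have distE : `|#|composition_solutions l a N|%:R - p.-1%:R^-1 * 'C(N.-1, l.-1)%:R| =
    (nat_dist (p.-1 * #|composition_solutions l a N|) 'C(N.-1, l.-1))%:R / p.-1%:R :> R.
  rewrite -norm_natrB natrM -[X in _ / X](gtr0_norm q0) -normf_div; congr `|_|.
  by field; rewrite gt_eqF.
(* For l = 1 there is at most one solution, so the difference is at most 1 in absolute value; the
   negative power of ln p is absorbed by ln p <= p. *)
move: hl; rewrite leq_eqVlt => /predU1P[l1|l2].
  move: a a0 distE; rewrite -l1 => a a0 _.
  have le1 : (#|composition_solutions 1 a N| <= 1)%N.
    rewrite -[leqRHS](bin0 N.-1) -(@card_compositions 1) //; apply: subset_leq_card.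
    by apply/fintype.subsetP => f; rewrite inE => /andP[].
  rewrite bin0 mulr1.
  have i1 : p.-1%:R^-1 <= 1 :> R by rewrite invf_le1 // ler1n; lia.
  have i0 : 0 <= p.-1%:R^-1 :> R by rewrite invr_ge0 ltW.
  have b1 : `|#|composition_solutions 1 a N|%:R - p.-1%:R^-1| <= 1 :> R.
    have : #|composition_solutions 1 a N|%:R <= 1 :> R by rewrite lern1.
    have : 0 <= #|composition_solutions 1 a N|%:R :> R by rewrite ler0n.
    by rewrite ler_norml; lra.
  apply: (@le_trans _ _ 1); first by rewrite exprn_ile1.
  have -> : (1 - 2) / 4 = - (1 / 4) :> R by field.
  rewrite powRN exprVn (@powR_expn _ _ _ 8 2) //; last by field.
  have lnp : 0 < ln p%:R :> R by lra.
  rewrite mulrA ler_pdivlMr ?exprn_gt0 // mul1r.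
  apply: (@le_trans _ _ (p%:R ^+ 2)).
    rewrite ler_pXn2r ?nnegrE ?ler0n //.
    have := @le_ln1Dx R (p%:R - 1); rewrite [1 + _]addrC subrK => /(_ ltac:(lra)); lra.
  apply: (@le_trans _ _ (p%:R ^+ (1 + 6))); first by rewrite ler_weXn2l.
  apply: (@le_trans _ _ (N%:R ^+ (6 * 1) * p%:R ^+ (1 + 6))).
    by rewrite ler_peMl ?exprn_ge0 ?ler0n // exprn_ege1.
  by rewrite ler_peMl ?mulr_ge0 ?exprn_ge0 ?ler0n // exprn_ege1 // ler1n.
have [k lE] : exists k, l = (k + 2)%N by exists (l - 2)%N; rewrite subnK.
have lnE : (l%:R - 2) / 4 = k%:R / 4 :> R by rewrite lE natrD addrK.
rewrite distE expr_div_n ler_pdivrMr ?exprn_gt0 // lnE (@powR_expn _ _ _ 8 (2 * k)) //; last first.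
  by rewrite natrM; field.
have := composition_solutions_bound p_pr p_gt2 N0 lN l2 a0.
rewrite -(ler_nat R) natrX => /le_trans; apply.
rewrite [in leLHS]natrM !natrX [in (_ * _)%:R ^+ 8]natrM [(_ * p)%:R]natrM.
rewrite [(48 ^ 4 * _)%:R]natrM !natrX lE addnK.
by apply: power_comparison => //; apply: ltW.
Qed.
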